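(* Let $\lambda>0$ and let $\alpha,\beta>1$ be integers. Consider solutions $u(t,x)$, $t\ge0$, $x\in\mathbb{R}^2$, of $$\frac{\partial u}{\partial t}(t,x)=\lambda(1-u(t,x))\,\bar u(t,x)^\alpha-u(t,x)\,(1-\bar u(t,x))^\beta,$$ with continuous initial condition $u(0,\cdot):\mathbb{R}^2\to[0,1]$, where $\bar u(t,x)$ is the average of $u(t,y)$ over the ball $D(x,1)$ of radius 1 around $x$. Let $c^*(\xi)$, $\xi\in S^1$, be the plane-wave speeds, let $\mathcal{S}=\{x\in\mathbb{R}^2: x\cdot\xi\le c^*(\xi)\text{ for all }\xi\in S^1\}$, and let $\pi_0\in(0,1)$ be the unstable fixed point (see context). Suppose that the interior $\mathcal{S}^o\ne\emptyset$, i.e., $c^*(\xi)>0$ for all directions $\xi$. (a) Let $\mathcal{S}^-$ be a closed subset of $\mathcal{S}^o$. For any $\sigma>\pi_0$ there is a radius $r_\sigma$ so that if $u(0,x)\ge\sigma$ on a ball of radius $r_\sigma$, then $$\liminf_{n\to\infty}\ \min_{x\in n\mathcal{S}^-}u(n,x)=1.$$ (b) If $u(0,x)=0$ off of a compact set and $\mathcal{S}^+$ is a bounded open set containing $\mathcal{S}$, then $$\liminf_{n\to\infty}\ \max_{x\notin n\mathcal{S}^+}u(n,x)\le\pi_0.$$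
   Context: Here $n$ ranges over positive integers. $\pi_0$ is the unique fixed point in $(0,1)$ of the ODE $\frac{du}{dt}=\lambda(1-u)u^\alpha-u(1-u)^\beta$; it is unstable, while $0$ and $1$ are stable. Plane-wave speeds: for a direction $\xi$ in the unit circle $S^1$, consider plane-wave solutions $u(t,x)=w(x\cdot\xi-c^*(\xi)t)$ of the integro-differential equation with $\lim_{s\to-\infty}w(s)=1$ and $\lim_{s\to\infty}w(s)=0$. The existence of such solutions and the uniqueness of the speed are known. Since the interaction neighborhood is a ball, $c^*(\xi)$ does not depend on $\xi$: $c^*(\xi)=v$ for all $\xi$, where $v=v(\lambda)$ is the speed of the one-dimensional traveling wave $w(s-vt)$ of the equation $$-v\,w'(s)=\lambda(1-w(s))\,\bar w(s)^\alpha-w(s)(1-\bar w(s))^\beta,\qquad \bar w(s)=\int_{-1}^{1}\tfrac{2}{\pi}\sqrt{1-r^2}\;w(s+r)\,dr .$$ *)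

(* Defs.v *)
From HB Require Import structures.
From mathcomp Require Import all_boot all_order all_algebra.
From mathcomp Require Import all_classical all_reals all_analysis.
Import Order.TTheory GRing.Theory Num.Theory.
Import numFieldNormedType.Exports.

Set Implicit Arguments.
Unset Strict Implicit.
Unset Printing Implicit Defensive.

Local Open Scope classical_set_scope.
Local Open Scope ring_scope.

(* The library norm of R * R is the sup norm; the Euclidean structure of the
   plane is therefore defined by hand. The product topology is the usual one. *)
Definition dot (R : realType) (x y : R * R) : R := x.1 * y.1 + x.2 * y.2.

Definition enorm (R : realType) (x : R * R) : R := Num.sqrt (dot x x).

Definition disk (R : realType) (x : R * R) (r : R) : set (R * R) :=
  [set y | enorm (y - x) <= r].

Definition unit_circle (R : realType) : set (R * R) := [set xi | enorm xi = 1].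

Definition scale (R : realType) (a : R) (A : set (R * R)) : set (R * R) :=
  [set (a * x.1, a * x.2) | x in A].

Definition lebesgue2 (R : realType) :
    set (measurableTypeR R * measurableTypeR R) -> \bar R :=
  (@lebesgue_measure R \x @lebesgue_measure R)%E.

Definition avg (R : realType) (f : R * R -> R) (x : R * R) : R :=
  (fine (lebesgue2 (disk x 1)))^-1
    * (\int[@lebesgue2 R]_(y in disk x 1) f y)%R.

Definition reaction (R : realType) (lambda : R) (alpha beta : nat) (u m : R) : R :=
  lambda * (1 - u) * m ^+ alpha - u * (1 - m) ^+ beta.

Definition is_interior_fixed_point (R : realType) (lambda : R)
    (alpha beta : nat) (p : R) : Prop :=
  0 < p < 1 /\ reaction lambda alpha beta p p = 0.

(* Values of u at negative times are irrelevant. The boundedness and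
   measurability clauses delimit the class of solutions; they put the averages
   [avg (u t) x] in the domain of the Lebesgue integral. *)
Definition is_solution (R : realType) (lambda : R) (alpha beta : nat)
    (u : R -> R * R -> R) : Prop :=
  [/\ forall T : R, exists M : R, forall (t : R) (x : R * R),
        0 <= t <= T -> `|u t x| <= M,
      forall t : R, 0 <= t ->
        measurable_fun [set: measurableTypeR R * measurableTypeR R]
          (u t : measurableTypeR R * measurableTypeR R -> measurableTypeR R),
      forall x : R * R, {within `[0, +oo[, continuous (fun t : R => u t x)} &
      forall (x : R * R) (t : R), 0 < t ->
        is_derive t 1 (fun s : R => u s x)
          (reaction lambda alpha beta (u t x) (avg (u t) x))].

Definition is_plane_wave_speed (R : realType) (lambda : R) (alpha beta : nat)
    (xi : R * R) (c : R) : Prop :=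
  exists w : R -> R,
    [/\ forall s : R, 0 <= w s <= 1,
        is_solution lambda alpha beta (fun t x => w (dot x xi - c * t)),
        w s @[s --> -oo] --> (1 : R) &
        w s @[s --> +oo] --> (0 : R)].

Definition spread_set (R : realType) (cstar : R * R -> R) : set (R * R) :=
  [set x | forall xi : R * R, unit_circle xi -> dot x xi <= cstar xi].

Definition admissible_init (R : realType) (u0 : R * R -> R) : Prop :=
  continuous u0 /\ forall x : R * R, 0 <= u0 x <= 1.

(* Main.v *)
(* Part (b).  A plane wave of speed [c] dominates [u] at time 1 after a shift:
   where [u] vanishes initially this follows by comparison on a half-plane, and
   elsewhere [u] is at time 1 bounded away from 1, hence below the wave shifted
   far to the right.  Comparison then gives decay beyond speed [c] in every
   direction, because averages over disks are rotation invariant and so the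
   profile of one plane wave serves all directions.

   Part (a).  If the speed [c] is positive, sliding the profile [w] along itself
   shows that it is decreasing with [w' < 0].  For [c1 < c], small [q] and large
   [R0] the function [w (|x| - R0 - c1 t) - q] is then a subsolution: in the
   front the speed deficit yields slack proportional to [- w'], near 0 and 1 the
   stability of these states yields slack proportional to [q], and the curvature
   of a large circle is negligible.  Below this expanding plateau, growth along
   the scalar equation from above [pi0] lifts [u] first to [1 - q] and finally
   arbitrarily close to 1. *)

Require Import Defs.
From HB Require Import structures.
From mathcomp Require Import all_boot all_order all_algebra.
From mathcomp Require Import all_classical all_reals all_analysis.
From mathcomp Require Import measurable_realfun ring lra.
Import Order.TTheory GRing.Theory Num.Theory.
Import numFieldNormedType.Exports.

Set Implicit Arguments.
Unset Strict Implicit.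
Unset Printing Implicit Defensive.

Local Open Scope classical_set_scope.
Local Open Scope ring_scope.

(** * Lebesgue measure of the plane *)

Section plane_measure.
Variable R : realType.

Local Notation mR := (measurableTypeR R).
Local Notation plane := (mR * mR)%type.

(** A solution need not attain its supremum over the plane, so comparison cannot be run at a first
    touching point. The maximum principle used instead iterates: on a short time interval a bound
    [S] for the positive part improves to [S / 2], hence the positive part vanishes. It needs
    regularity in time only. Touching arguments are reserved for the wave profile, whose limits at
    both ends confine extrema to a compact interval.

    A speed [cstar xi] is given for each direction, and that these numbers agree is never
    established. One well chosen direction suffices: in part (a) that of the point of [Sm] farthest
    from the origin, in part (b) one that separates from the spread set the point nearest to the
    origin outside [Sp].

    The radius in part (a) must not depend on how close to 1 the solution is to come. Hence two
    lifts: one over a ball of fixed radius only starts the plateau; the other draws on the growing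
    plateau, which eventually contains balls of any radius. *)

Lemma pushforward_translation (a : R) (A : set mR) : measurable A ->
  pushforward (@lebesgue_measure R) ((+%R^~ a) : mR -> mR) A =
  lebesgue_measure A.
Proof.
have m : measurable_fun [set: mR] ((+%R^~ a) : mR -> mR).
  by apply: measurable_funD => //; exact: measurable_id.
pose m1 := isMeasurableFun.Build _ _ _ _ _ m.
pose f : {mfun mR >-> mR} := HB.pack ((+%R^~ a) : mR -> mR) m1.
move=> mA; apply/esym.
apply: (lebesgue_measure_unique (mu := pushforward (@lebesgue_measure R) f)) mA.
move=> X; case=> -[x y] _ <- /=; rewrite /pushforward.
rewrite (_ : _ @^-1` _ = [set` `]x - a, y - a]]); last first.
  by apply/seteqP; split => z /=; rewrite !in_itv/= ltrBlDr lerBrDr.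
rewrite !lebesgue_measure_itv /= !lte_fin ltrD2r; case: ifP => // _.
by rewrite -!EFinD; congr (_%:E); lra.
Qed.

Lemma ge0_integral_translation (a : R) (f : mR -> \bar R) :
  measurable_fun setT f -> (forall x, (0 <= f x)%E) ->
  (\int[@lebesgue_measure R]_x f (x + a)%R = \int[@lebesgue_measure R]_x f x)%E.
Proof.
move=> mf f0.
have m : measurable_fun [set: mR] ((+%R^~ a) : mR -> mR).
  by apply: measurable_funD => //; exact: measurable_id.
have := ge0_integral_pushforward m (@lebesgue_measure R) measurableT
  mf (fun x _ => f0 x).
rewrite preimage_setT => <-.
by apply: eq_measure_integral => A mA _; exact: pushforward_translation.
Qed.

(** Phrased through integrals of nonnegative functions rather than measures of sets, so that shears
    follow from Tonelli and composition is immediate. *)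
Definition measure_preserving (phi : plane -> plane) :=
  measurable_fun setT phi /\
  forall f : plane -> \bar R, measurable_fun setT f -> (forall z, (0 <= f z)%E) ->
    (\int[@lebesgue2 R]_z f (phi z) = \int[@lebesgue2 R]_z f z)%E.

Lemma measure_preserving_comp (phi psi : plane -> plane) :
  measure_preserving phi -> measure_preserving psi ->
  measure_preserving (phi \o psi).
Proof.
move=> [mphi iphi] [mpsi ipsi]; split; first exact: (measurableT_comp mphi mpsi).
move=> f mf f0; rewrite -(iphi f mf f0).
exact: (ipsi (f \o phi) (measurableT_comp mf mphi) (fun z => f0 _)).
Qed.

(** By Tonelli the inner integral runs along the sheared coordinate, where the map is a translation
    by the constant [a y]. *)
Lemma measure_preserving_shear1 (a : mR -> mR) : measurable_fun setT a ->
  measure_preserving (fun z => (z.1 + a z.2, z.2)).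
Proof.
move=> ma.
have mphi : measurable_fun setT (fun z : plane => (z.1 + a z.2, z.2) : plane).
  apply: measurable_fun_pair; last exact: measurable_snd.
  apply: measurable_funD; first exact: measurable_fst.
  by apply: measurableT_comp => //; exact: measurable_snd.
split=> // f mf f0; rewrite [LHS]fubini_tonelli2; last 2 first.
- exact: (measurableT_comp mf mphi).
- by move=> z; exact: f0.
rewrite [RHS](fubini_tonelli2 _ mf f0); apply: eq_integral => y _.
rewrite /fubini_G /=.
apply: (@ge0_integral_translation (a y) (fun x => f (x, y))) => //.
exact: measurableT_comp.
Qed.

Lemma measure_preserving_shear2 (a : mR -> mR) : measurable_fun setT a ->
  measure_preserving (fun z => (z.1, z.2 + a z.1)).
Proof.
move=> ma.
have mphi : measurable_fun setT (fun z : plane => (z.1, z.2 + a z.1) : plane).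
  apply: measurable_fun_pair; first exact: measurable_fst.
  apply: measurable_funD; first exact: measurable_snd.
  by apply: measurableT_comp => //; exact: measurable_fst.
split=> // f mf f0; rewrite [LHS]fubini_tonelli1; last 2 first.
- exact: (measurableT_comp mf mphi).
- by move=> z; exact: f0.
rewrite [RHS](fubini_tonelli1 _ mf f0); apply: eq_integral => x _.
rewrite /fubini_F /=.
apply: (@ge0_integral_translation (a x) (fun y => f (x, y))) => //.
exact: measurableT_comp.
Qed.

Lemma measure_preserving_translation (x : R * R) :
  measure_preserving (fun z => (z.1 + x.1, z.2 + x.2)).
Proof.
exact: (measure_preserving_comp
  (measure_preserving_shear1 (a := cst x.1) (measurable_cst _))
  (measure_preserving_shear2 (a := cst x.2) (measurable_cst _))).
Qed.

Definition rot (xi z : R * R) : R * R :=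
  (xi.1 * z.1 - xi.2 * z.2, xi.2 * z.1 + xi.1 * z.2).

(* A rotation by an angle [theta <> pi] is a product of three shears, with
   parameters [tan (theta / 2) = xi.2 / (1 + xi.1)] and [sin theta = xi.2]. *)
Lemma measure_preserving_rot_neqN1 (xi : R * R) : dot xi xi = 1 -> xi.1 != -1 ->
  measure_preserving (rot xi : plane -> plane).
Proof.
rewrite /dot => xi1 xiN1; have d0 : 1 + xi.1 != 0.
  by apply: contra xiN1 => /eqP h; apply/eqP; lra.
have [t e e'] : exists2 t, xi.2 * t = 1 - xi.1 & xi.1 * t = xi.2 - t.
  exists (xi.2 / (1 + xi.1)); last by field.
  rewrite mulrA (_ : xi.2 * xi.2 = (1 - xi.1) * (1 + xi.1)) ?mulfK//.
  by rewrite mulrBl mul1r mulrDr mulr1; lra.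
have mt (k : R) : measurable_fun [set: mR] (fun y : mR => k * y : mR).
  by apply: measurable_funM => //; exact: measurable_id.
have := measure_preserving_comp
  (measure_preserving_comp (measure_preserving_shear1 (mt (- t)))
    (measure_preserving_shear2 (mt xi.2))) (measure_preserving_shear1 (mt (- t))).
congr measure_preserving; apply/funext => -[a b] /=; rewrite /rot /=.
congr (_, _); last by ring: e.
rewrite [LHS](_ : _ = a * (1 - xi.2 * t) - t * b - (1 - xi.2 * t) * t * b);
  last by ring.
by rewrite e; ring: e'.
Qed.

(** The half turn, where the shear parameter blows up, is the square of a quarter turn. *)
Lemma measure_preserving_rot (xi : R * R) : dot xi xi = 1 ->
  measure_preserving (rot xi : plane -> plane).
Proof.
move=> xi1; have [xiN1|] := eqVneq xi.1 (-1); last exact: measure_preserving_rot_neqN1.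
have xi20 : xi.2 = 0.
  by move: xi1; rewrite /dot xiN1 => h; apply/eqP; rewrite -sqrf_eq0 expr2; apply/eqP; lra.
have q : measure_preserving (rot (0, 1) : plane -> plane).
  apply: measure_preserving_rot_neqN1; rewrite /dot /=; first by ring.
  by rewrite eq_sym oppr_eq0 oner_eq0.
have := measure_preserving_comp q q; congr measure_preserving.
by apply/funext => -[a b]; rewrite /rot /= xiN1 xi20; congr (_, _); ring.
Qed.

Lemma measure_preserving_integral (phi : plane -> plane) (D E : set plane)
    (f : plane -> R) : measure_preserving phi -> measurable E ->
  phi @^-1` E = D -> measurable_fun setT f ->
  (\int[@lebesgue2 R]_(z in D) (f (phi z))%:E =
   \int[@lebesgue2 R]_(z in E) (f z)%:E)%E.
Proof.
move=> [mphi iphi] mE DE mf.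
rewrite [LHS]integral_mkcond [RHS]integral_mkcond.
set F := (fun z => (f z)%:E) \_ E.
rewrite [LHS](_ : _ = \int[@lebesgue2 R]_z (F \o phi) z)%E; last first.
  by apply: eq_integral => z _; rewrite /F /= !patchE -DE.
have mF : measurable_fun setT F.
  apply/(measurable_restrictT (fun z => (f z)%:E) mE).
  by apply/measurable_EFinP; exact: measurable_funTS.
rewrite [LHS]integralE [RHS]integralE funepos_comp funeneg_comp.
congr (_ - _)%E; apply: iphi => //.
- exact: measurable_funepos.
- exact: measurable_funeneg.
Qed.
End plane_measure.

(** * Averages over disks *)

Section euclidean_plane.
Variable R : realType.
Implicit Types x y z xi : R * R.

Lemma dot_ge0 x : 0 <= dot x x.
Proof. by rewrite /dot -!expr2 addr_ge0 // sqr_ge0. Qed.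

Lemma enorm_ge0 x : 0 <= enorm x.
Proof. exact: sqrtr_ge0. Qed.

Lemma sqr_enorm x : enorm x ^+ 2 = dot x x.
Proof. by rewrite sqr_sqrtr// dot_ge0. Qed.

Lemma enorm_le x (r : R) : 0 <= r -> (enorm x <= r) = (dot x x <= r ^+ 2).
Proof. by move=> r0; rewrite -sqr_enorm ler_sqr// ?nnegrE ?enorm_ge0. Qed.

Lemma cauchy_schwarz x y : dot x y <= enorm x * enorm y.
Proof.
rewrite -sqrtrM ?dot_ge0//; apply: le_trans (ler_norm _) _.
rewrite -sqrtr_sqr ler_sqrt; last by rewrite mulr_ge0 ?dot_ge0.
rewrite /dot -subr_ge0.
rewrite (_ : _ - _ = (x.1 * y.2 - x.2 * y.1) ^+ 2) ?sqr_ge0//; ring.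
Qed.

Lemma enormD x y : enorm (x + y) <= enorm x + enorm y.
Proof.
rewrite enorm_le ?addr_ge0 ?enorm_ge0// sqrrD !sqr_enorm.
have := cauchy_schwarz x y; rewrite /dot/=; lra.
Qed.

Lemma unit_circle_dot xi : unit_circle xi -> dot xi xi = 1.
Proof. by rewrite /unit_circle/= => h; rewrite -sqr_enorm h expr1n. Qed.

Lemma dot_le_enorm x xi : unit_circle xi -> dot x xi <= enorm x.
Proof. by move=> u; have := cauchy_schwarz x xi; rewrite u mulr1. Qed.

Lemma disk_dot x y xi (r : R) : unit_circle xi -> disk x r y ->
  dot x xi - r <= dot y xi <= dot x xi + r.
Proof.
move=> u; rewrite /disk/= => yx.
have := dot_le_enorm (y - x) u.
have : dot (- (y - x)) xi <= enorm (y - x).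
  have -> : enorm (y - x) = enorm (- (y - x)) by rewrite /enorm /dot /=; congr Num.sqrt; ring.
  exact: dot_le_enorm.
by rewrite /dot/=; lra.
Qed.

Lemma disk_enorm x y (r : R) : disk x r y ->
  enorm x - r <= enorm y <= enorm x + r.
Proof.
rewrite /disk/= => yx.
have := enormD (y - x) x; rewrite subrK.
have := enormD (x - y) y; rewrite subrK.
have -> : enorm (x - y) = enorm (y - x) by rewrite /enorm /dot /=; congr Num.sqrt; ring.
lra.
Qed.

Lemma coord_le_enorm x : `|x.1| <= enorm x /\ `|x.2| <= enorm x.
Proof.
by split; rewrite -sqrtr_sqr ler_sqrt ?dot_ge0// expr2 /dot ?lerDl ?lerDr -expr2 sqr_ge0.
Qed.

Definition e1 : R * R := (1, 0).

Lemma unit_circle_e1 : unit_circle e1.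
Proof. by rewrite /unit_circle /= /enorm /dot /= !mulr0 mulr1 addr0 sqrtr1. Qed.

Lemma enorm_eq0 x : enorm x = 0 -> x = 0.
Proof.
move=> x0; have [] := coord_le_enorm x; rewrite x0 !normr_le0 => /eqP h1 /eqP h2.
by case: x h1 h2 {x0} => a b /= -> ->.
Qed.

(* Any unit vector will do at the origin. *)
Lemma polar x : exists2 xi, unit_circle xi & dot x xi = enorm x.
Proof.
have [/enorm_eq0 ->|x0] := eqVneq (enorm x) 0.
  exists e1; first exact: unit_circle_e1.
  by rewrite /enorm /dot /= !mul0r addr0 sqrtr0.
have h : enorm x * enorm x = x.1 * x.1 + x.2 * x.2 by rewrite -expr2 sqr_enorm.
exists (x.1 / enorm x, x.2 / enorm x); rewrite /unit_circle /=; last first.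
  by rewrite /dot /= !mulrA -mulrDl -h mulfK.
rewrite {1}/enorm /dot /=.
rewrite (_ : _ + _ = 1) ?sqrtr1// !mulf_div -mulrDl -h.
by rewrite mulfV// mulf_neq0.
Qed.

Lemma dot_rot xi x y : dot xi xi = 1 -> dot (rot xi x) (rot xi y) = dot x y.
Proof.
move=> h; rewrite -[RHS]mul1r -h /rot /dot /=; ring.
Qed.

Lemma dot_rot_unit xi y : dot xi xi = 1 -> dot (rot xi y) xi = y.1.
Proof.
move=> h; have -> : y.1 = dot y e1 by rewrite /dot /=; ring.
rewrite -(dot_rot y e1 h); congr dot; rewrite /rot /=.
by case: xi h => a b _ /=; congr (_, _); ring.
Qed.
End euclidean_plane.
Arguments e1 {R}.

(** This is the average with density [2 / pi * sqrt (1 - r ^ 2)], the length of a chord of the disk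
    divided by its area; the density itself is never computed. *)
HB.lock Definition lavg (R : realType) (w : R -> R) (s : R) : R :=
  avg (fun y => w y.1) (s, 0).

Section average.
Variable R : realType.
Implicit Types x y z xi : R * R.

Local Notation mR := (measurableTypeR R).
Local Notation plane := (mR * mR)%type.

Lemma measurable_enorm : measurable_fun setT (@enorm R : plane -> mR).
Proof.
apply: (measurableT_comp (f := @Num.sqrt R : mR -> mR)).
  by apply: continuous_measurable_fun; exact: sqrt_continuous.
by apply: measurable_funD; apply: measurable_funM;
  (exact: measurable_fst || exact: measurable_snd).
Qed.

Lemma measurable_dot xi : measurable_fun setT ((fun x => dot x xi) : plane -> mR).
Proof.
by apply: measurable_funD; apply: measurable_funM;
  (exact: measurable_fst || exact: measurable_snd || exact: measurable_cst).
Qed.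

Lemma measurable_disk x (r : R) : measurable (disk x r : set plane).
Proof.
have m : measurable_fun setT ((fun y => enorm (y - x)) : plane -> mR).
  apply: (measurableT_comp measurable_enorm).
  have [m _] := measure_preserving_translation (- x); exact: m.
have := m measurableT [set` `]-oo, r]] (measurable_itv _).
by rewrite setTI; congr measurable; apply/seteqP; split => y /=; rewrite in_itv.
Qed.

Definition box (b : R * R) (h : R) : set (R * R) :=
  `[b.1 - h, b.1 + h] `*` `[b.2 - h, b.2 + h].

Lemma measurable_box b (h : R) : measurable (box b h : set plane).
Proof. exact: measurableX. Qed.

Lemma lebesgue2_box b (h : R) : 0 < h ->
  lebesgue2 (box b h) = (4 * h ^+ 2)%:E.
Proof.
move=> h0; rewrite /lebesgue2 product_measure1E//= !lebesgue_measure_itv /=.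
rewrite !lte_fin !ifT; [|lra..].
by rewrite -!EFinD -EFinM; congr (_%:E); ring.
Qed.

Lemma lebesgue2_disk_lty x : (lebesgue2 (disk x 1) < +oo)%E.
Proof.
apply: (@le_lt_trans _ _ (lebesgue2 (box x 1))); last first.
  by rewrite lebesgue2_box// ltry.
apply: le_measure; rewrite ?inE; [exact: measurable_disk|exact: measurable_box|].
move=> y; rewrite /disk/= => yx; have [] := coord_le_enorm (y - x).
by rewrite !ler_norml /box /= !in_itv /= => *; split; lra.
Qed.

Lemma lebesgue2_disk_gt0 x : 0 < fine (lebesgue2 (disk x 1)).
Proof.
apply: fine_gt0; rewrite lebesgue2_disk_lty andbT.
apply: (@lt_le_trans _ _ (lebesgue2 (box x (1 / 2)))).
  by rewrite lebesgue2_box// lte_fin; lra.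
apply: le_measure; rewrite ?inE; [exact: measurable_box|exact: measurable_disk|].
move=> y []; rewrite /= !in_itv /= => /andP[h1 h2] /andP[h3 h4].
rewrite /disk/= enorm_le// expr1n /dot /=; nra.
Qed.

Definition bounded_measurable (f : R * R -> R) :=
  measurable_fun setT (f : plane -> mR) /\ exists M, forall x, `|f x| <= M.

Lemma bounded_measurable_cst (c : R) : bounded_measurable (fun=> c).
Proof. by split; [exact: measurable_cst | exists `|c|]. Qed.

Lemma bounded_measurableD f g : bounded_measurable f -> bounded_measurable g ->
  bounded_measurable (fun x => f x + g x).
Proof.
move=> [mf [M hM]] [mg [N hN]]; split; first exact: measurable_funD.
by exists (M + N) => x; apply: le_trans (ler_normD _ _) _; exact: lerD.
Qed.

Lemma bounded_measurableZ (a : R) f : bounded_measurable f ->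
  bounded_measurable (fun x => a * f x).
Proof.
move=> [mf [M hM]]; split.
  by apply: measurable_funM => //; exact: measurable_cst.
by exists (`|a| * M) => x; rewrite normrM ler_wpM2l.
Qed.

Lemma integrable_disk f x : bounded_measurable f ->
  (@lebesgue2 R).-integrable (disk x 1) (EFin \o f).
Proof.
move=> [mf [M hM]]; apply: measurable_bounded_integrable.
- exact: measurable_disk.
- exact: lebesgue2_disk_lty.
- exact: measurable_funTS.
- exists M; split; first exact: num_real.
  by move=> N MN y _ /=; exact: le_trans (hM y) (ltW MN).
Qed.

Lemma avg_le f g x : bounded_measurable f -> bounded_measurable g ->
  (forall y, disk x 1 y -> f y <= g y) -> avg f x <= avg g x.
Proof.
move=> bf bg fg; rewrite /avg ler_pM2l ?invr_gt0 ?lebesgue2_disk_gt0//.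
by apply: le_Rintegral => //; [exact: measurable_disk|exact: integrable_disk..].
Qed.

Lemma avg_cst (c : R) x : avg (fun=> c) x = c.
Proof.
rewrite /avg (Rintegral_cst (@lebesgue2 R) (measurable_disk x 1)) mulrC mulfK//.
by rewrite gt_eqF// lebesgue2_disk_gt0.
Qed.

Lemma avgD f g x : bounded_measurable f -> bounded_measurable g ->
  avg (fun y => f y + g y) x = avg f x + avg g x.
Proof.
move=> bf bg; rewrite /avg -mulrDr; congr (_ * _).
by rewrite RintegralD//; [exact: measurable_disk|exact: integrable_disk..].
Qed.

Lemma avgZ (a : R) f x : bounded_measurable f ->
  avg (fun y => a * f y) x = a * avg f x.
Proof.
move=> bf; rewrite /avg mulrCA; congr (_ * _).
by rewrite RintegralZl//; [exact: measurable_disk|exact: integrable_disk].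
Qed.

Lemma avg_measure_preserving (phi : plane -> plane) f x y :
  measure_preserving phi -> phi @^-1` disk y 1 = disk x 1 ->
  measurable_fun setT (f : plane -> mR) ->
  avg (fun z => f (phi z)) x = avg f y.
Proof.
move=> pphi xy mf; have md := measurable_disk y 1.
have c z : (\int[@lebesgue2 R]_(_ in disk z 1) 1)%E = lebesgue2 (disk z 1).
  by rewrite integral_cst ?mul1e//; exact: measurable_disk.
have hm : lebesgue2 (disk x 1) = lebesgue2 (disk y 1).
  rewrite -!c.
  exact: (measure_preserving_integral (f := cst 1) pphi md xy (measurable_cst _)).
by rewrite /avg hm /Rintegral (measure_preserving_integral pphi md xy mf).
Qed.

Lemma avg_translation f x y : measurable_fun setT (f : plane -> mR) ->
  avg f (x + y) = avg (fun z => f (z + y)) x.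
Proof.
move=> mf; apply/esym.
apply: (avg_measure_preserving (measure_preserving_translation y)) => //.
by apply/seteqP; split => z; rewrite /disk /=;
  congr (enorm _ <= 1); case: z x y => a b [c d] [e f0]; congr (_, _) => /=; ring.
Qed.

Lemma avg_rot f xi : dot xi xi = 1 -> measurable_fun setT (f : plane -> mR) ->
  avg (fun z => f (rot xi z)) 0 = avg f 0.
Proof.
move=> xi1 mf.
apply: (avg_measure_preserving (measure_preserving_rot xi1)) => //.
by apply/seteqP; split => z; rewrite /disk /= !subr0 /enorm dot_rot.
Qed.

(** Comparison with [eta] times the indicator of the box. The factor [k] depends on the box only, so
    the bound is uniform over points and times. *)
Lemma avg_ge_box (b : R * R) (h : R) : 0 < h -> box b h `<=` disk 0 1 ->
  exists2 k, 0 < k & forall f x eta, bounded_measurable f -> 0 <= eta ->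
    (forall y, 0 <= f y) -> (forall y, box (x + b) h y -> eta <= f y) ->
    k * eta <= avg f x.
Proof.
move=> h0 bd; pose m := fine (lebesgue2 (disk (0 : R * R) 1)).
exists (m^-1 * (4 * h ^+ 2)).
  by rewrite mulr_gt0 ?invr_gt0 ?lebesgue2_disk_gt0// mulr_gt0// exprn_gt0.
move=> f x eta bf eta0 f0 fbox.
have mb := measurable_box b h.
rewrite -[x in avg f x](add0r x) avg_translation; last by case: bf.
have bi : bounded_measurable (\1_(box b h) : R * R -> R).
  split; first exact: measurable_indic.
  by exists 1 => y; rewrite indicE; case: (_ \in _); rewrite /= ?normr1 ?normr0.
have bfx : bounded_measurable (fun z => f (z + x)).
  case: bf => mf [M hM]; split; last by exists M.
  have [mt _] := measure_preserving_translation x.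
  exact: (measurableT_comp mf mt).
have -> : m^-1 * (4 * h ^+ 2) * eta = avg (fun y => eta * \1_(box b h) y) 0.
  rewrite avgZ// mulrC; congr (_ * _); rewrite /avg; congr (_ * _).
  rewrite /Rintegral integral_indic//; last exact: measurable_disk.
  by rewrite setIidl//; exact/esym/(congr1 fine (lebesgue2_box b h0)).
apply: avg_le => //; first exact: bounded_measurableZ.
move=> y _; rewrite indicE; case: (boolP (y \in _)) => [yb|_]; last by rewrite mulr0.
rewrite mulr1; apply: fbox; move: yb; rewrite inE /box /= !in_itv /=.
by move=> [/andP[h1 h2] /andP[h3 h4]]; split; apply/andP; split; lra.
Qed.

(** After translation to the origin, the rotation taking [e1] to [xi] turns the planar function into
    one of the first coordinate. *)
Lemma avg_plane (w : R -> R) xi x (k : R) : unit_circle xi ->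
  measurable_fun setT (w : mR -> mR) ->
  avg (fun y => w (dot y xi - k)) x = lavg w (dot x xi - k).
Proof.
move=> /unit_circle_dot xi1 mw; set s := dot x xi - k.
have ms (c : R) : measurable_fun [set: mR] ((+%R^~ c) : mR -> mR).
  by apply: measurable_funD => //; exact: measurable_id.
have m1 : measurable_fun setT ((fun y => w (dot y xi - k)) : plane -> mR).
  apply: (measurableT_comp mw).
  by apply: (measurableT_comp (ms (- k))); exact: measurable_dot.
have m2 : measurable_fun setT ((fun y => w (dot y xi + s)) : plane -> mR).
  apply: (measurableT_comp mw).
  by apply: (measurableT_comp (ms s)); exact: measurable_dot.
have m3 : measurable_fun setT ((fun y => w y.1) : plane -> mR).
  by apply: (measurableT_comp mw); exact: measurable_fst.
rewrite lavg.unlock -[x in LHS](add0r x) -[(s, 0)]add0r !avg_translation//.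
have -> : (fun z => w (dot (z + x) xi - k)) = (fun z => w (dot z xi + s)).
  by apply/funext => z; congr w; rewrite /s /dot /=; ring.
rewrite -(avg_rot xi1 m2); congr (avg _ 0); apply/funext => z.
by rewrite dot_rot_unit.
Qed.
End average.

(** * Maximum principle and reaction term *)

Section maximum_principle.
Variable R : realType.

Lemma last_nonpositive (f : R -> R) (a b : R) : a <= b ->
  {within `[a, b], continuous f} -> f a <= 0 -> 0 < f b ->
  exists c, [/\ a <= c, c < b, f c <= 0 & forall t, c < t <= b -> 0 < f t].
Proof.
move=> ab cf fa fb; pose E := [set t | a <= t <= b /\ f t <= 0].
have Ea : E a by rewrite /E /= lexx.
have ubE : ubound E b by move=> t [/andP[]].
have supE : has_sup E by split; [exists a | exists b].
have aE : a <= sup E by apply: ub_le_sup => //; exists b.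
have Eb : sup E <= b by apply: ge_sup => //; exists a.
have fE : f (sup E) <= 0.
  rewrite leNgt; apply/negP => fpos.
  have /(_ (sup E)) := (subspace_continuousP _ _).1 cf.
  rewrite /= in_itv/= aE Eb => /(_ isT) /cvgr_gt /(_ _ fpos).
  rewrite near_withinE => /nbhs_ballP[e /= e0 he].
  have [t [tab ft] et] := sup_adherent e0 supE.
  have tE : t <= sup E by apply: ub_le_sup => //; exists b.
  have := he t; rewrite /ball /= in_itv/= => /(_ _ tab).
  move=> h; have : 0 < f t by apply: h; rewrite ger0_norm; lra.
  by rewrite ltNge ft.
exists (sup E); split => //.
  by rewrite lt_neqAle Eb andbT; apply/eqP => h; move: fE; rewrite h; lra.
move=> t /andP[ct tb]; rewrite ltNge; apply/negP => ft.
suff : t <= sup E by lra.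
by apply: ub_le_sup; [exists b | split => //; rewrite tb andbT; lra].
Qed.

Section max_principle.
Variables (X : Type) (z dz : R -> X -> R) (B K : R).
Hypotheses (B0 : 0 <= B) (K0 : 0 <= K).

Let max_principle_hyp (a b : R) :=
  [/\ forall t x, a <= t <= b -> z t x <= B,
      forall x, {within `[a, b], continuous (z^~ x)},
      forall t x, a < t < b -> 0 < z t x -> is_derive t 1 (z^~ x) (dz t x) &
      forall t x S, a < t < b -> 0 <= S <= B -> (forall y, z t y <= S) ->
        0 < z t x -> dz t x <= K * S].

(** If [z <= S] everywhere, then since its last nonpositive time [z] has grown at each point by at
    most [K * S * (b - a) <= S / 2]. Iterating from [B] gives [z <= B * 2^-1 ^+ n] for all [n]. *)
Let short_max_principle (a b : R) : K * (b - a) <= 2^-1 ->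
  max_principle_hyp a b -> (forall x, z a x <= 0) ->
  forall t x, a <= t <= b -> z t x <= 0.
Proof.
move=> Kab [zB cz dzE hdz] za.
have halve n : forall t x, a <= t <= b -> z t x <= B * 2^-1 ^+ n.
  elim: n => [|n IH] t x tab; first by rewrite expr0 mulr1 zB.
  set S := B * 2^-1 ^+ n in IH.
  have S0 : 0 <= S by rewrite mulr_ge0// exprn_ge0.
  have SB : S <= B by apply: ler_piMr => //; apply: exprn_ile1; lra.
  rewrite exprSr mulrA -/S; have [z0|zpos] := leP (z t x) 0.
    by apply: le_trans z0 _; lra.
  have /andP[at_ tb] := tab.
  have czt : {within `[a, t], continuous (z^~ x)}.
    apply: continuous_subspaceW (cz x) => s /=; rewrite !in_itv/= => ?; lra.
  have [c [ac ct zc cpos]] := last_nonpositive at_ czt (za x) zpos.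
  have [s||r] := @MVT _ (z^~ x) (dz^~ x) c t ct.
  - rewrite in_itv/= => sct; apply: dzE; first lra.
    by apply: cpos; lra.
  - by apply: continuous_subspaceW czt => s /=; rewrite !in_itv/= => ?; lra.
  - rewrite in_itv/= => rct zdz.
    have : dz r x <= K * S.
      apply: hdz; [lra|by rewrite S0|by move=> y; apply: IH; lra|].
      by apply: cpos; lra.
    move=> dzKS; have h1 : dz r x * (t - c) <= K * S * (t - c).
      by rewrite ler_wpM2r//; lra.
    have h2 : S * (K * (t - c)) <= S * 2^-1.
      rewrite ler_wpM2l//; apply: le_trans Kab; rewrite ler_wpM2l//; lra.
    rewrite -[z t x](subrK (z c x)) zdz; lra.
move=> t x tab; rewrite leNgt; apply/negP => zpos.
have [m Bm] : exists m : nat, B < z t x * m%:R.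
  exists (Num.bound (B / z t x)); rewrite mulrC -ltr_pdivrMr//.
  by apply: le_lt_trans (archi_boundP _) => //; exact: divr_ge0 (ltW zpos).
have := halve m t x tab; rewrite exprVn ler_pdivlMr ?exprn_gt0//.
move=> /le_lt_trans /(_ Bm); rewrite ltr_pM2l// -natrX ltr_nat.
by rewrite ltnNge ltnW// ltn_expl.
Qed.

(** The interval is cut into [N] pieces short enough for the halving argument. The index type is
    arbitrary: it is instantiated by points, by points of a region, and by points paired with a
    Boolean. The bound on [dz] is asked only for [S <= B], because [K] may depend on [B]. *)
Lemma max_principle (a b : R) :
  (forall t x, a <= t <= b -> z t x <= B) ->
  (forall x, {within `[a, b], continuous (z^~ x)}) ->
  (forall t x, a < t < b -> 0 < z t x -> is_derive t 1 (z^~ x) (dz t x)) ->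
  (forall t x S, a < t < b -> 0 <= S <= B -> (forall y, z t y <= S) ->
    0 < z t x -> dz t x <= K * S) ->
  (forall x, z a x <= 0) ->
  forall t x, a <= t <= b -> z t x <= 0.
Proof.
move=> h1 h2 h3 h4 za t x tab; have /andP[at_ tb] := tab.
have sub (c d : R) : a <= c -> d <= b -> max_principle_hyp c d.
  move=> ac db; split.
  - by move=> s y scd; apply: h1; lra.
  - by move=> y; apply: continuous_subspaceW (h2 y) => s /=; rewrite !in_itv/= => ?; lra.
  - by move=> s y scd; apply: h3; lra.
  - by move=> s y S scd; apply: h4; lra.
pose N := (Num.bound (2 * K * (b - a))).+1.
have N0 : (0 : R) < N%:R by rewrite ltr0n.
have hN : K * ((b - a) / N%:R) <= 2^-1.
  have : 2 * K * (b - a) < N%:R.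
    apply: lt_trans (archi_boundP _) _; last by rewrite ltr_nat.
    by rewrite !mulr_ge0//; lra.
  rewrite mulrA ler_pdivrMr//; lra.
pose h := (b - a) / N%:R; have h0 : 0 <= h by rewrite divr_ge0//; lra.
have hNE : h * N%:R = b - a by rewrite /h divfK// gt_eqF.
suff main n : (n <= N)%N -> forall s y, a <= s <= a + h * n%:R -> z s y <= 0.
  by apply: (main N) => //; rewrite hNE; lra.
elim: n => [|n IH] nN s y.
  rewrite mulr0 addr0 => sa; have -> : s = a by lra.
  exact: za.
rewrite -natr1 mulrDr mulr1 => sn.
have hn : h * (n.+1)%:R <= h * N%:R by rewrite ler_wpM2l// ler_nat.
have hn0 : 0 <= h * n%:R by rewrite mulr_ge0.
have [sl|sl] := leP s (a + h * n%:R); first by apply: (IH (ltnW nN)); lra.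
apply: (short_max_principle (a := a + h * n%:R) (b := a + h * n%:R + h)).
- by rewrite (_ : _ - _ = h)//; ring.
- by apply: sub; [lra | move: hn; rewrite hNE -natr1 mulrDr mulr1; lra].
- by move=> y'; apply: (IH (ltnW nN)); lra.
- lra.
Qed.
End max_principle.
End maximum_principle.

(** * Monotonicity and Lipschitz bounds of the reaction term *)

Section reaction_term.
Variables (R : realType) (lambda : R) (alpha beta : nat).
Hypotheses (lambda_gt0 : 0 < lambda) (alpha_gt1 : (1 < alpha)%N)
  (beta_gt1 : (1 < beta)%N).

Local Notation f := (reaction lambda alpha beta).

Let lambda_ge0 : 0 <= lambda. Proof. exact: ltW. Qed.

Definition lip : R := lambda * alpha%:R + beta%:R.

Lemma lip_gt0 : 0 < lip.
Proof. by rewrite addr_gt0 ?mulr_gt0 ?ltr0n// (ltn_trans (ltn0Sn 0)). Qed.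

Lemma subrX_le (k : nat) (x y c : R) : 0 <= x <= y -> y <= c ->
  y ^+ k.+1 - x ^+ k.+1 <= k.+1%:R * c ^+ k * (y - x).
Proof.
move=> /andP[x0 xy] yc; elim: k => [|k IH]; first by rewrite !expr1 expr0 !mul1r.
have hx : x ^+ k.+1 <= c ^+ k.+1 by rewrite lerXn2r ?nnegrE//; lra.
have hc : 0 <= c ^+ k by rewrite exprn_ge0//; lra.
rewrite exprS [x ^+ _]exprS -[k.+2%:R]natr1 [c ^+ k.+1]exprS.
rewrite [leLHS](_ : _ = y * (y ^+ k.+1 - x ^+ k.+1) + x ^+ k.+1 * (y - x)); last by ring.
rewrite mulrDl mul1r mulrDl; apply: lerD.
  apply: le_trans (ler_wpM2l _ IH) _; first lra.
  rewrite [leLHS](_ : _ = y * (k.+1%:R * c ^+ k * (y - x))) //.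
  rewrite [leRHS](_ : _ = c * (k.+1%:R * c ^+ k * (y - x))); last by ring.
  by rewrite ler_wpM2r// !mulr_ge0//; lra.
by rewrite -exprS ler_wpM2r//; lra.
Qed.

Lemma reactionE (u m : R) :
  f u m = lambda * m ^+ alpha - u * (lambda * m ^+ alpha + (1 - m) ^+ beta).
Proof. by rewrite /reaction; ring. Qed.

Lemma reaction_decr (u u' m : R) : u <= u' -> 0 <= m <= 1 -> f u' m <= f u m.
Proof.
move=> uu' /andP[m0 m1]; rewrite !reactionE lerD2l lerN2 ler_wpM2r//.
apply: addr_ge0; last by apply: exprn_ge0; lra.
by apply: mulr_ge0; [exact: ltW | exact: exprn_ge0].
Qed.

(* With [c = 1] this is the global Lipschitz bound, with small [c] and the
   exponents [alpha, beta > 1] it shows that 0 and 1 are attracting. *)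
Lemma reaction_incr_le (u m m' c d : R) : 0 <= u <= 1 -> 0 <= m <= m' ->
  m' <= 1 -> m' <= c -> 1 - m <= d -> c <= 1 -> d <= 1 ->
  f u m' - f u m <= (lambda * alpha%:R * (1 - u) * c + beta%:R * u * d) * (m' - m).
Proof.
move=> u01 mm' m'1 m'c md c1 d1.
have hpow (k : nat) (x : R) : (1 < k)%N -> 0 <= x <= 1 -> k%:R * x ^+ k.-1 <= k%:R * x.
  case: k => [|[|k]]//= _ /andP[x0 x1].
  by rewrite ler_wpM2l// exprS ler_piMr// exprn_ile1.
have c01 : 0 <= c <= 1 by lra.
have d01 : 0 <= d <= 1 by lra.
have [ha hb] : m' ^+ alpha - m ^+ alpha <= alpha%:R * c * (m' - m) /\
    (1 - m) ^+ beta - (1 - m') ^+ beta <= beta%:R * d * (m' - m).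
  split.
  - have := subrX_le alpha.-1 mm' m'c; rewrite prednK ?(ltn_trans _ alpha_gt1)//.
    move=> /le_trans; apply; rewrite ler_wpM2r//; first lra.
    exact: hpow.
  - have h : 0 <= 1 - m' <= 1 - m by lra.
    have := subrX_le beta.-1 h md; rewrite prednK ?(ltn_trans _ beta_gt1)//.
    move=> /le_trans; apply; rewrite (_ : 1 - m - (1 - m') = m' - m); last by ring.
    rewrite ler_wpM2r//; first lra.
    exact: hpow.
rewrite /reaction.
rewrite [leLHS](_ : _ = lambda * (1 - u) * (m' ^+ alpha - m ^+ alpha) +
  u * ((1 - m) ^+ beta - (1 - m') ^+ beta)); last by ring.
rewrite [leRHS](_ : _ = lambda * (1 - u) * (alpha%:R * c * (m' - m)) +
  u * (beta%:R * d * (m' - m))); last by ring.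
by apply: lerD; rewrite ler_wpM2l ?mulr_ge0//; lra.
Qed.

Lemma reaction_lip (u m m' : R) : 0 <= u <= 1 -> 0 <= m <= m' -> m' <= 1 ->
  f u m' - f u m <= lip * (m' - m).
Proof.
move=> u01 mm' m'1.
apply: le_trans (reaction_incr_le (c := 1) (d := 1) u01 mm' _ _ _ _ _) _ => //; try lra.
rewrite ler_wpM2r//; first lra.
have := mulr_ge0 (ltW lambda_gt0) (ler0n R alpha); have := ler0n R beta.
rewrite /lip; nra.
Qed.

Lemma reaction_incr (u m m' : R) : 0 <= u <= 1 -> 0 <= m <= m' -> m' <= 1 ->
  f u m <= f u m'.
Proof.
move=> u01 mm' m'1; rewrite /reaction lerD//.
  by rewrite ler_wpM2l ?lerXn2r ?nnegrE ?mulr_ge0//; lra.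
by rewrite lerN2 ler_wpM2l ?lerXn2r ?nnegrE//; lra.
Qed.

Lemma reaction_lip_norm (u m m' : R) : 0 <= u <= 1 -> 0 <= m <= 1 -> 0 <= m' <= 1 ->
  `|f u m' - f u m| <= lip * `|m' - m|.
Proof.
move=> u01 m01 m'01; wlog mm' : m m' m01 m'01 / m <= m'.
  move=> h; have [|/ltW] := leP m m'; first exact: h.
  by rewrite (distrC (f u m')) (distrC m'); exact: h.
rewrite !ger0_norm ?subr_ge0//.
  by apply: reaction_lip => //; lra.
by apply: reaction_incr => //; lra.
Qed.

(** The form in which the derivative bound of [max_principle] gets verified: raising [u] to [v]
    lowers the reaction, and an excess [S] in the average costs at most [lip * S]. *)
Lemma reaction_compare (u v m m' S : R) : u <= v -> 0 <= v <= 1 ->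
  0 <= m <= 1 -> 0 <= m' <= 1 -> 0 <= S -> m' <= m + S ->
  f v m' - f u m <= lip * S.
Proof.
move=> uv v01 m01 m'01 S0 mS; have h1 := reaction_decr uv m01.
have l0 := ltW lip_gt0; suff : f v m' - f v m <= lip * S by lra.
have [m'm|/ltW m'm] := leP m' m.
  apply: (@le_trans _ _ 0); last exact: mulr_ge0.
  by rewrite subr_le0; apply: reaction_incr => //; lra.
apply: (@le_trans _ _ (lip * (m' - m))); first by apply: reaction_lip => //; lra.
by rewrite ler_wpM2l//; lra.
Qed.
End reaction_term.

(** * Comparison of solutions *)

Section comparison.
Variables (R : realType) (lambda : R) (alpha beta : nat).
Hypotheses (lambda_gt0 : 0 < lambda) (alpha_gt1 : (1 < alpha)%N)
  (beta_gt1 : (1 < beta)%N).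

Local Notation f := (reaction lambda alpha beta).
Local Notation lip := (lip lambda alpha beta).

Let lambda_ge0 : 0 <= lambda. Proof. exact: ltW. Qed.
Let lip_ge0 : 0 <= lip. Proof. exact/ltW/lip_gt0. Qed.

Lemma solution_bounded_measurable u t : is_solution lambda alpha beta u ->
  0 <= t -> bounded_measurable (u t).
Proof.
move=> [ub um _ _] t0; split; first exact: um.
by have [M hM] := ub t; exists M => x; apply: hM; rewrite t0 lexx.
Qed.

Lemma solution_continuous u x (a b : R) : is_solution lambda alpha beta u ->
  0 <= a -> {within `[a, b], continuous (fun t => u t x)}.
Proof.
move=> [_ _ cu _] a0; apply: continuous_subspaceW (cu x) => t /=.
by rewrite !in_itv/= => ?; lra.
Qed.

Lemma opp_exp_le (k : nat) (y S B : R) : 0 <= S <= B -> - S <= y ->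
  - y ^+ k.+1 <= S * (1 + B) ^+ k.
Proof.
move=> /andP[S0 SB] Sy; have [y0|y0] := leP 0 y.
  apply: (@le_trans _ _ 0); first by rewrite oppr_le0 exprn_ge0.
  by rewrite mulr_ge0// exprn_ge0//; lra.
apply: le_trans (ler_norm _) _; rewrite normrN normrX exprS ltr0_norm//.
apply: ler_pM; [lra|by apply: exprn_ge0; lra|lra|].
by apply: lerXn2r; rewrite ?nnegrE; lra.
Qed.

Lemma norm_exp_le (k : nat) (y B : R) : - B <= y <= 1 + B -> 0 <= B ->
  `|y ^+ k| <= (1 + B) ^+ k.
Proof.
move=> yB B0; rewrite normrX; apply: lerXn2r; rewrite ?nnegrE; [exact: normr_ge0|lra|].
by rewrite ler_norml; lra.
Qed.

(** Outside the unit interval terms may have the wrong sign, depending on the parity of the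
    exponents. The damage is linear in the overshoot, since one factor of each offending term is at
    most [S] in size. *)
Lemma reaction_outside (B S U m : R) : 0 <= S <= B -> - S <= U <= 1 + S ->
  - S <= m <= 1 + S ->
  let K := lambda * (1 + B) ^+ alpha + (1 + B) ^+ beta in
  (1 < U -> f U m <= K * S) /\ (U < 0 -> - f U m <= K * S).
Proof.
move=> SB US mS K; have /andP[S0 SBB] := SB; have B0 := le_trans S0 SBB.
have a0 := prednK (ltn_trans (ltn0Sn 0) alpha_gt1).
have b0 := prednK (ltn_trans (ltn0Sn 0) beta_gt1).
rewrite /reaction /K mulrDl; split=> Upos.
- have h1 : - (1 - m) ^+ beta <= S * (1 + B) ^+ beta.-1.
    by rewrite -[in leLHS]b0; apply: (opp_exp_le _ SB); lra.
  have h2 : `|m ^+ alpha| <= (1 + B) ^+ alpha by apply: norm_exp_le => //; lra.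
  have h3 : (1 + B) * (S * (1 + B) ^+ beta.-1) = (1 + B) ^+ beta * S.
    by rewrite -[in RHS]b0 exprS; ring.
  rewrite -h3; apply: lerD.
    rewrite -!mulrA ler_wpM2l// [leRHS]mulrC.
    apply: le_trans (ler_norm _) _; rewrite normrM ler_pM//.
    by rewrite ler0_norm; lra.
  rewrite -mulrN; apply: le_trans (ler_wpM2l _ h1) _; first lra.
  rewrite ler_wpM2r ?mulr_ge0 ?exprn_ge0//; lra.
- have h1 : - m ^+ alpha <= S * (1 + B) ^+ alpha.-1.
    by rewrite -[in leLHS]a0; apply: (opp_exp_le _ SB); lra.
  have h2 : `|(1 - m) ^+ beta| <= (1 + B) ^+ beta by apply: norm_exp_le => //; lra.
  have h3 : (1 + B) * (S * (1 + B) ^+ alpha.-1) = (1 + B) ^+ alpha * S.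
    by rewrite -[in RHS]a0 exprS; ring.
  rewrite opprB addrC; apply: lerD.
    rewrite -!mulrA -h3 -mulrN ler_wpM2l// -mulrN.
    apply: le_trans (ler_wpM2l _ h1) _; first lra.
    by rewrite ler_wpM2r ?mulr_ge0 ?exprn_ge0//; lra.
  rewrite [leRHS]mulrC; apply: le_trans (ler_norm _) _; rewrite normrM ler_pM//.
  by rewrite ltr0_norm; lra.
Qed.

Lemma solution_unit u : is_solution lambda alpha beta u ->
  (forall x, 0 <= u 0 x <= 1) -> forall t x, 0 <= t -> 0 <= u t x <= 1.
Proof.
move=> su u01 T x T0; have [ub um cu du] := su.
have [M hM] := ub T.
have M0 : 0 <= M by apply: le_trans (normr_ge0 _) (hM T x _); rewrite T0 lexx.
pose B := M + 1; have B0 : 0 <= B by rewrite /B; lra.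
(* Both violations, above 1 and below 0, are tracked at once by the Boolean: bounding either of them
   requires control of the average on both sides. *)
pose z t (xb : (R * R) * bool) := if xb.2 then u t xb.1 - 1 else - u t xb.1.
pose dz t (xb : (R * R) * bool) :=
  let v := f (u t xb.1) (avg (u t) xb.1) in if xb.2 then v else - v.
pose K := lambda * (1 + B) ^+ alpha + (1 + B) ^+ beta.
have K1 : 0 <= lambda * (1 + B) ^+ alpha by rewrite mulr_ge0// exprn_ge0//; lra.
have K2 : 0 <= (1 + B) ^+ beta by rewrite exprn_ge0//; lra.
have K0 : 0 <= K by rewrite addr_ge0.
suff main : forall t xb, 0 <= t <= T -> z t xb <= 0.
  have hT : 0 <= T <= T by rewrite T0 lexx.
  by have := main T (x, true) hT; have := main T (x, false) hT; rewrite /z /=; lra.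
apply: (max_principle (z := z) (dz := dz) B0 K0); last by
  move=> [y b]; have := u01 y; rewrite /z; case: b => /=; lra.
- move=> t [y b] tT; have := hM t y tT; rewrite ler_norml /z /B.
  by case: b => /=; lra.
- move=> [y []] /=; rewrite /z /=.
  + move=> t; apply: (@continuousB _ _ (subspace _)); last exact: cst_continuous.
    exact: (solution_continuous su (lexx 0)).
  + by move=> t; apply: continuousN; exact: (solution_continuous su (lexx 0)).
- move=> t [y b] /andP[t0 _] _; have := du y t t0; rewrite /z /dz.
  case: b => /= h; last exact: is_deriveN.
  by rewrite -[X in is_derive _ _ _ X]subr0; exact: is_deriveB.
move=> t [y b] S tT SB zS; have t0 : 0 <= t by lra.
have uS y' : - S <= u t y' <= 1 + S.
  by have := zS (y', true); have := zS (y', false); rewrite /z /=; lra.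
have bu := solution_bounded_measurable su t0.
have mS : - S <= avg (u t) y <= 1 + S.
  apply/andP; split; [rewrite -[leLHS](avg_cst _ y)|rewrite -[leRHS](avg_cst _ y)];
    apply: avg_le => [||y' _] //; try exact: bounded_measurable_cst.
  - by have := uS y'; lra.
  - by have := uS y'; lra.
have [h1 h2] := reaction_outside SB (uS y) mS.
by rewrite /z /dz; case: b => /=; [rewrite subr_gt0|rewrite oppr_gt0].
Qed.

Definition unit_solution (u : R -> R * R -> R) :=
  is_solution lambda alpha beta u /\ forall t x, 0 <= t -> 0 <= u t x <= 1.

Lemma avg_unit u t x : unit_solution u -> 0 <= t -> 0 <= avg (u t) x <= 1.
Proof.
move=> [su u01] t0; have bu := solution_bounded_measurable su t0.
apply/andP; split; [rewrite -[leLHS](avg_cst _ x)|rewrite -[leRHS](avg_cst _ x)];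
  apply: avg_le => [||y' _] //; try exact: bounded_measurable_cst.
- by have := u01 t y' t0; lra.
- by have := u01 t y' t0; lra.
Qed.

(* Outside [D] only the ordering within distance 1 of [D] matters. *)
Lemma comparison (D : set (R * R)) (a b : R) u v :
  unit_solution u -> unit_solution v -> 0 <= a ->
  (forall x, D x -> u a x <= v a x) ->
  (forall t x y, a <= t <= b -> D x -> disk x 1 y -> ~ D y -> u t y <= v t y) ->
  forall t x, a <= t <= b -> D x -> u t x <= v t x.
Proof.
move=> uu uv a0 uva uvD t x tab Dx; have [su u01] := uu; have [sv v01] := uv.
(* The index type is the region itself, so the maximum principle does not see the outside; [uvD]
   covers the part of the averaging disk that leaves [D]. *)
pose z t (y : {y | D y}) := u t (sval y) - v t (sval y).
pose dz t (y : {y | D y}) := f (u t (sval y)) (avg (u t) (sval y)) -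
  f (v t (sval y)) (avg (v t) (sval y)).
suff : z t (exist _ x Dx) <= 0 by rewrite subr_le0.
apply: (max_principle (z := z) (dz := dz) ler01 lip_ge0 (a := a) (b := b)) => //.
- by move=> s y sab; have := u01 s (sval y); have := v01 s (sval y); rewrite /z; lra.
- move=> y s; apply: (@continuousB _ _ (subspace _)).
    exact: (solution_continuous su a0).
  exact: (solution_continuous sv a0).
- move=> s y sab _; have [_ _ _ du] := su; have [_ _ _ dv] := sv.
  by apply: is_deriveB; [apply: du|apply: dv]; lra.
- move=> s [y Dy] S sab S01 zS; rewrite /z /dz /= subr_gt0 => vu.
  have s0 : 0 <= s by lra.
  have uS y' : disk y 1 y' -> u s y' <= v s y' + S.
    move=> dy; have [Dy'|nDy'] := pselect (D y').
      by have := zS (exist _ y' Dy'); rewrite /z /=; lra.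
    by have := uvD s y y' _ Dy dy nDy'; lra.
  have bu := solution_bounded_measurable su s0.
  have bv := solution_bounded_measurable sv s0.
  have : avg (u s) y <= avg (v s) y + S.
    rewrite -[X in _ <= _ + X](avg_cst S y) -avgD//; last exact: bounded_measurable_cst.
    by apply: avg_le => //; apply: bounded_measurableD => //; exact: bounded_measurable_cst.
  have := avg_unit y uu s0; have := avg_unit y uv s0.
  move=> m'01 m01 mm'; apply: reaction_compare => //; [exact: ltW|exact: u01|].
  by have /andP[] := S01.
- by move=> y; rewrite subr_le0; apply: uva; case: y.
Qed.

Lemma is_derive_affine (k c t : R) : is_derive t 1 (fun s => k * s + c) k.
Proof.
have := is_deriveD (is_deriveZ k (is_derive_id t (1 : R))) (is_derive_cst c t 1).
by rewrite addr0 /GRing.scale /= mulr1.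
Qed.

Lemma is_derive_expR_affine (k c t : R) :
  is_derive t 1 (fun s => expR (k * s + c)) (k * expR (k * t + c)).
Proof.
have := is_derive1_comp (g := fun s => k * s + c) (is_derive_expR (k * t + c))
  (is_derive_affine k c t).
by rewrite mulrC.
Qed.

(** The exponential is a supersolution for the linear bound [lambda * m] on the reaction: averaging
    over a unit disk multiplies it by at most [expR 1], whence the rate [lambda * expR 1]. *)
Lemma solution_le_expR u xi (C : R) : unit_solution u -> unit_circle xi ->
  (forall x, C <= dot x xi -> u 0 x = 0) ->
  forall t x, 0 <= t -> u t x <= expR (lambda * expR 1 * t + (C - dot x xi)).
Proof.
move=> uu xi1 u0 T x T0; have [su u01] := uu.
pose psi t x := expR (lambda * expR 1 * t + (C - dot x xi)).
have psi0 t y : 0 < psi t y by exact: expR_gt0.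
have psiD t y y' : disk y 1 y' -> psi t y' <= expR 1 * psi t y.
  move=> /(disk_dot xi1) yy'; rewrite /psi -expRD ler_expR; lra.
pose z t y := u t y - psi t y.
pose dz t y := f (u t y) (avg (u t) y) - lambda * expR 1 * psi t y.
suff : z T x <= 0 by rewrite subr_le0.
apply: (max_principle (z := z) (dz := dz) ler01 lambda_ge0 (a := 0) (b := T)) => //.
- by move=> s y sT; have := u01 s y; have := psi0 s y; rewrite /z; lra.
- move=> y s; apply: (@continuousB _ _ (subspace `[0, T]) (fun t => u t y) (fun t => psi t y)).
    exact: (solution_continuous su (lexx 0)).
  apply: continuous_subspaceT => r; apply/differentiable_continuous/derivable1_diffP.
  by have [] := is_derive_expR_affine (lambda * expR 1) (C - dot y xi) r.
- move=> s y sT _; have [_ _ _ du] := su.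
  by apply: is_deriveB; [apply: du; lra|exact: is_derive_expR_affine].
- move=> s y S sT S01 zS; rewrite /z /dz /= subr_gt0 => vu.
  have s0 : 0 <= s by lra.
  have bu := solution_bounded_measurable su s0.
  have mS : avg (u s) y <= expR 1 * psi s y + S.
    rewrite -[leRHS](avg_cst _ y); apply: avg_le => //; first exact: bounded_measurable_cst.
    by move=> y' /(psiD s); have := zS y'; rewrite /z; lra.
  have := avg_unit y uu s0; have := u01 s y s0; move: mS.
  set m := avg (u s) y; set U := u s y => mS U01 m01.
  have h1 : m ^+ alpha <= m.
    by rewrite -[leRHS]expr1; apply: ler_wiXn2l => //; [lra|lra|exact: ltnW].
  have h2 : 0 <= U * (1 - m) ^+ beta by rewrite mulr_ge0// ?exprn_ge0//; lra.
  have h3 : lambda * (1 - U) * m ^+ alpha <= lambda * m.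
    rewrite -mulrA ler_wpM2l//; apply: le_trans h1.
    by rewrite ler_piMl ?exprn_ge0//; lra.
  have h4 : lambda * m <= lambda * (expR 1 * psi s y + S) by rewrite ler_wpM2l.
  by rewrite /reaction; lra.
- move=> y; rewrite subr_le0 /psi mulr0 add0r; have [/u0 ->|yC] := leP C (dot y xi).
    exact: expR_ge0.
  apply: le_trans (_ : 1 <= _); first by have := u01 0 y; lra.
  by rewrite -expR0 ler_expR; lra.
- by rewrite T0 lexx.
Qed.

(** The subsolution is a linear function of slope [mu] minus an error [E] that is at least 1 outside
    the ball at time [s0] and decays exponentially towards the center. Averaging multiplies [E] by
    at most [expR 1], so letting it grow at rate [lip * expR 1] absorbs the coupling. *)
Lemma solution_ge_linear u (s0 T sigma nu mu r : R) x0 : unit_solution u ->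
  0 <= s0 -> 0 <= T -> 0 <= sigma -> nu <= 1 -> 0 <= mu ->
  (forall p, sigma <= p <= nu -> mu <= f p p) -> sigma + mu * T <= nu ->
  (forall x, disk x0 r x -> sigma <= u s0 x) ->
  sigma + mu * T - expR (lip * expR 1 * T - r) <= u (s0 + T) x0.
Proof.
move=> uu s00 T0 sg0 nu1 mu0 hmu sT us0; have [su u01] := uu.
pose L := lip * expR 1.
pose E t x := expR (L * t + (enorm (x - x0) - r - L * s0)).
have E0 t y : 0 < E t y by exact: expR_gt0.
have ED t y y' : disk y 1 y' -> E t y' <= expR 1 * E t y.
  rewrite /disk /= => yy'; rewrite /E -expRD ler_expR.
  have := enormD (y' - y) (y - x0).
  by rewrite (_ : y' - y + (y - x0) = y' - x0) ?addrA ?subrK//; lra.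
pose p t := mu * t + (sigma - mu * s0).
pose z t y := p t - E t y - u t y.
pose dz t y := mu - L * E t y - f (u t y) (avg (u t) y).
suff : z (s0 + T) x0 <= 0.
  rewrite /z /p /E subrr (_ : enorm 0 = 0) ?enorm_eq0//; last first.
    by rewrite /enorm /dot /= !mulr0 addr0 sqrtr0.
  rewrite [X in expR X](_ : _ = L * T - r); last by ring.
  by rewrite mulrDr; lra.
have pT t : s0 <= t <= s0 + T -> sigma <= p t <= nu.
  move=> tT; have : mu * (t - s0) <= mu * T by rewrite ler_wpM2l//; lra.
  have : 0 <= mu * (t - s0) by rewrite mulr_ge0//; lra.
  by rewrite /p mulrBr; lra.
have dp (t : R) : is_derive t (1 : R) p mu by exact: is_derive_affine.
apply: (@max_principle R _ z dz 1 lip ler01 lip_ge0 s0 (s0 + T)).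
- move=> t y tT; have := pT t tT; have := E0 t y; have := u01 t y; rewrite /z; lra.
- move=> y t; apply: (@continuousB _ _ (subspace `[s0, s0 + T])
    (fun t => p t - E t y) (fun t => u t y)); last exact: (solution_continuous su s00).
  apply: continuous_subspaceT => s; apply/differentiable_continuous/derivable1_diffP.
  apply: derivableB; first by have [] := dp s.
  by have [] := is_derive_expR_affine L (enorm (y - x0) - r - L * s0) s.
- move=> t y tT _; have [_ _ _ du] := su.
  by apply: is_deriveB; [apply: is_deriveB; exact: is_derive_expR_affine|apply: du; lra].
- move=> t y S tT S01 zS; rewrite /z /dz /= subr_gt0 => up.
  have t0 : 0 <= t by lra.
  have bu := solution_bounded_measurable su t0.
  have mS : p t - expR 1 * E t y - S <= avg (u t) y.
    rewrite -[leLHS](avg_cst _ y); apply: avg_le => //; first exact: bounded_measurable_cst.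
    by move=> y' /(ED t); have := zS y'; rewrite /z; lra.
  have pt : sigma <= p t <= nu by apply: pT; lra.
  have := avg_unit y uu t0; have := u01 t y t0; move: mS; have := E0 t y.
  set m := avg (u t) y; set U := u t y in up * => Ety mS U01 m01.
  have hp := hmu _ pt.
  have up' : U <= p t by lra.
  have h0 : 0 <= expR 1 * E t y by rewrite mulr_ge0 ?expR_ge0.
  have h2 : f (p t) (p t) - f U m <= lip * (expR 1 * E t y + S).
    by apply: reaction_compare => //; lra.
  have h3 : lip * (expR 1 * E t y + S) = L * E t y + lip * S by rewrite /L; ring.
  rewrite h3 in h2; lra.
- move=> y; have ps0 : p s0 = sigma by rewrite /p; ring.
  rewrite subr_le0 ps0 /E.
  rewrite [X in expR X](_ : _ = enorm (y - x0) - r); last by ring.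
  have := expR_gt0 (enorm (y - x0) - r); have := u01 s0 y s00.
  have [/us0|yr] := leP (enorm (y - x0)) r; first lra.
  have : 1 <= expR (enorm (y - x0) - r) by rewrite -expR0 ler_expR; lra.
  by have := pT s0; rewrite ps0; lra.
- by rewrite lexx andbT; lra.
Qed.
End comparison.

(** * Plane waves and the outer bound *)

Section plane_waves.
Variables (R : realType) (lambda : R) (alpha beta : nat).
Hypotheses (lambda_gt0 : 0 < lambda) (alpha_gt1 : (1 < alpha)%N)
  (beta_gt1 : (1 < beta)%N).

Local Notation f := (reaction lambda alpha beta).
Local Notation mR := (measurableTypeR R).
Local Notation unit_solution := (unit_solution lambda alpha beta).

Let lambda_ge0 : 0 <= lambda. Proof. exact: ltW. Qed.

(** The direction has been removed. The equation is kept along [t |-> a - c * t] because [c] may be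
    zero, and then it says nothing about the derivative of [w] itself. *)
Definition wave_profile (c : R) (w : R -> R) :=
  [/\ forall s, 0 <= w s <= 1,
      measurable_fun setT (w : mR -> mR),
      forall a : R, {within `[0, +oo[, continuous (fun t => w (a - c * t))},
      forall a t : R, 0 < t -> is_derive t (1 : R) (fun t => w (a - c * t))
        (f (w (a - c * t)) (lavg w (a - c * t))) &
      (forall e, 0 < e -> exists M, forall s, s <= M -> 1 - e <= w s) /\
      (forall e, 0 < e -> exists M, forall s, M <= s -> w s <= e)].

Lemma plane_wave_profile xi (c : R) : unit_circle xi ->
  is_plane_wave_speed lambda alpha beta xi c -> exists w, wave_profile c w.
Proof.
move=> xi1 [w [w01 [_ mw cw dw] w1 w0]]; exists w.
have xiE s : dot (s * xi.1, s * xi.2) xi = s.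
  by have := unit_circle_dot xi1; rewrite /dot /= => h; rewrite -!mulrA -mulrDr h mulr1.
have {}mw : measurable_fun setT (w : mR -> mR).
  have mxi : measurable_fun setT
      ((fun s => (s * xi.1, s * xi.2)) : mR -> mR * mR).
    by apply: measurable_fun_pair; apply: measurable_funM => //; exact: measurable_id.
  have := measurableT_comp (mw 0 (lexx 0)) mxi; congr measurable_fun.
  by apply/funext => s /=; rewrite xiE mulr0 subr0.
split => //.
- by move=> a; have := cw (a * xi.1, a * xi.2); rewrite xiE.
- move=> a t t0; have := dw (a * xi.1, a * xi.2) t t0.
  by rewrite (avg_plane (a * xi.1, a * xi.2) (c * t) xi1 mw) xiE.
split=> e e0.
- have /cvgrPdist_lt/(_ e e0)[M [_ hM]] := w1; exists (M - 1) => s sM.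
  by have := hM s _; rewrite ltr_norml /= => /(_ ltac:(lra)); lra.
- have /cvgrPdist_lt/(_ e e0)[M [_ hM]] := w0; exists (M + 1) => s sM.
  by have := hM s _; rewrite ltr_norml /= => /(_ ltac:(lra)); lra.
Qed.

Lemma wave_unit_solution (c k : R) w xi : wave_profile c w -> unit_circle xi ->
  unit_solution (fun t x => w (dot x xi - k - c * t)).
Proof.
move=> [w01 mw cw dw _] xi1; split; last by [].
split.
- by move=> T; exists 1 => t x _; rewrite ger0_norm; have := w01 (dot x xi - k - c * t); lra.
- move=> t t0; apply: (measurableT_comp mw).
  apply: measurable_funB; last exact: measurable_cst.
  by apply: measurable_funB; [exact: measurable_dot|exact: measurable_cst].
- by move=> x; exact: cw.
- move=> x t t0; have := dw (dot x xi - k) t t0; congr is_derive; congr f.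
  have -> : (fun y => w (dot y xi - k - c * t)) = (fun y => w (dot y xi - (k + c * t))).
    by apply/funext => y; rewrite opprD addrA.
  by rewrite (avg_plane x (k + c * t) xi1 mw) opprD addrA.
Qed.

(** Gronwall with the integrating factor [expR (k * t)], which lies between 1 and [expR k] on the
    unit time interval. *)
Lemma expR_lower_bound (v dv : R -> R) (a b k g : R) : 0 <= a -> a <= b -> b <= 1 ->
  0 <= k -> 0 <= g -> 0 <= v a ->
  {within `[a, b], continuous v} ->
  (forall t, a < t < b -> is_derive t 1 v (dv t)) ->
  (forall t, a < t < b -> g - k * v t <= dv t) ->
  (v a + g * (b - a)) * expR (- k) <= v b.
Proof.
move=> a0 ab b1 k0 g0 va cv dvE hdv.
have [ba|{}ab] := leP b a.
  have -> : b = a by lra.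
  by rewrite subrr mulr0 addr0 ler_piMr// -expR0 ler_expR; lra.
pose V t := v t * expR (k * t + 0).
pose dV t := dv t * expR (k * t + 0) + v t * (k * expR (k * t + 0)).
have VE (t : R) : t \in `]a, b[ -> is_derive t (1 : R) V (dV t).
  rewrite in_itv /= => tab.
  have := is_deriveM (dvE t tab) (is_derive_expR_affine k 0 t).
  by rewrite /GRing.scale /=; move=> /is_derive_eq; apply; rewrite /dV; ring.
have cV : {within `[a, b], continuous V}.
  move=> t; apply: (@continuousM _ (subspace `[a, b]) v (fun t => expR (k * t + 0))).
    exact: cv.
  apply: continuous_subspaceT => s; apply/differentiable_continuous/derivable1_diffP.
  by have [] := is_derive_expR_affine k 0 s.
have [r] := MVT ab VE cV; rewrite in_itv /= => rab VbVa.
have expR_ge1 t : 0 <= t -> 1 <= expR (k * t + 0).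
  by move=> t0; rewrite addr0 -expR0 ler_expR mulr_ge0.
have h1 : g <= dV r.
  rewrite /dV (_ : _ + _ = (dv r + k * v r) * expR (k * r + 0)); last by ring.
  have := hdv r rab; have := expR_ge1 r; move=> /(_ ltac:(lra)) h2 h3.
  apply: (@le_trans _ _ (g * expR (k * r + 0))); first by rewrite ler_peMr.
  by rewrite ler_wpM2r; lra.
have h2 : g * (b - a) <= dV r * (b - a) by rewrite ler_wpM2r//; lra.
have h3 : v a <= V a by rewrite /V ler_peMr// expR_ge1.
have h4 : v b = V b * expR (- (k * b)).
  by rewrite /V addr0 -mulrA -expRD subrr expR0 mulr1.
rewrite h4; apply: ler_pM; [|exact: expR_ge0|lra|].
  by rewrite addr_ge0// mulr_ge0//; lra.
by rewrite ler_expR lerN2 ler_piMr.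
Qed.

(** Positivity of [1 - u] spreads. It holds where [u] vanishes initially, and the average transmits
    it half a unit further to the left at the price of halving the waiting time; finitely many steps
    cover the strip that remains. *)
Lemma solution_le_lt1 u (R0 : R) : unit_solution u ->
  (forall x, R0 <= `|x.1| -> u 0 x = 0) ->
  exists2 eta, 0 < eta & forall x, u 1 x <= 1 - eta.
Proof.
move=> uu u0; have [su u01] := uu.
(* With [v = 1 - u] and [g] below [(1 - avg (u t) x) ^+ beta], the equation gives
   [v' >= g - (lambda + g) * v]. *)
have lower (a b g : R) x : 0 <= a -> a <= b -> b <= 1 -> 0 <= g ->
    (forall t, a < t < b -> g <= (1 - avg (u t) x) ^+ beta) ->
    (1 - u a x + g * (b - a)) * expR (- (lambda + g)) <= 1 - u b x.
  move=> a0 ab b1 g0 hg.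
  apply: (@expR_lower_bound (fun t => 1 - u t x)
    (fun t => - f (u t x) (avg (u t) x)) a b (lambda + g) g) => //.
  - exact: addr_ge0.
  - by have := u01 a x a0; lra.
  - move=> t; apply: (@continuousB _ _ (subspace `[a, b])
        (cst (1 : R)) (fun t => u t x)).
      exact: cst_continuous.
    exact: (solution_continuous su a0).
  - move=> t tab; have [_ _ _ du] := su; rewrite -[X in is_derive _ _ _ X]add0r.
    by apply: is_deriveB; apply: du; lra.
  - move=> t tab; have t0 : 0 <= t by lra.
    have := avg_unit x uu t0; have := u01 t x t0; have := hg t tab.
    rewrite /reaction; set m := avg (u t) x; set U := u t x => hgt U01 m01.
    have : U * g <= U * (1 - m) ^+ beta by rewrite ler_wpM2l//; lra.
    have : lambda * (1 - U) * m ^+ alpha <= lambda * (1 - U).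
      apply: ler_piMr; first by apply: mulr_ge0 => //; lra.
      by apply: exprn_ile1; lra.
    lra.
have base (t : R) x : 0 <= t <= 1 -> u 0 x = 0 -> expR (- lambda) <= 1 - u t x.
  move=> t01 ux; have := lower 0 t 0 x; rewrite ux !subr0 mul0r !addr0 mul1r.
  apply => //; try lra.
  by move=> s st; have := avg_unit x uu (t := s); move=> /(_ ltac:(lra)) ?; apply: exprn_ge0; lra.
(* Translated by [x], this box has first coordinates at least [x.1 + 1 / 2], and it still fits
   inside the unit disk. *)
have boxd : box ((5 / 8, 0) : R * R) (1 / 8) `<=` disk 0 1.
  move=> y [] /=; rewrite !in_itv /= => /andP[y1 y2] /andP[y3 y4].
  by rewrite /disk /= subr0 enorm_le// expr1n /dot; nra.
have h8 : 0 < 1 / 8 :> R by lra.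
have [k k0 hk] := avg_ge_box h8 boxd.
have step (j : nat) : forall t0, 0 < t0 <= 1 -> exists2 eta, 0 < eta &
    forall t x, t0 <= t <= 1 -> R0 - j%:R / 2 <= x.1 -> eta <= 1 - u t x.
  elim: j => [|j IH] t0 t01.
    exists (expR (- lambda)); first exact: expR_gt0.
    move=> t x tt0; rewrite mul0r subr0 => xR; apply: base; first lra.
    by apply: u0; apply: le_trans xR (ler_norm _).
  have [|eta eta0 heta] := IH (t0 / 2); first lra.
  pose g := (k * eta) ^+ beta.
  have g0 : 0 < g by rewrite exprn_gt0// mulr_gt0.
  exists (g * (t0 / 2) * expR (- (lambda + g))).
    by rewrite !mulr_gt0 ?expR_gt0//; lra.
  move=> t x tt0 xR.
  apply: le_trans (lower (t0 / 2) t g x _ _ _ _ _); try lra.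
    rewrite ler_wpM2r ?expR_ge0//.
    have : g * (t0 / 2) <= g * (t - t0 / 2) by rewrite ler_wpM2l//; lra.
    by have := u01 (t0 / 2) x; move=> /(_ ltac:(lra)); lra.
  move=> s st; have s0 : 0 <= s by lra.
  have bu := solution_bounded_measurable su s0.
  have bc := bounded_measurable_cst 1.
  have : k * eta <= avg (fun y => 1 + -1 * u s y) x.
    apply: hk => //; [|exact: ltW|by move=> y; have := u01 s y s0; lra|].
      by apply: bounded_measurableD => //; exact: bounded_measurableZ.
    move=> y [] /=; rewrite !in_itv /= => /andP[y1 y2] _.
    rewrite mulN1r; apply: heta; first lra.
    by move: xR; rewrite -natr1; lra.
  rewrite avgD//; last exact: bounded_measurableZ.
  rewrite avgZ// avg_cst mulN1r => h; rewrite /g lerXn2r// ?nnegrE.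
    by rewrite mulr_ge0// ltW.
  by apply: le_trans h; rewrite mulr_ge0// ltW.
(* Chosen so that [R0 - N%:R / 2] lies below minus the absolute value of [R0]. *)
pose N := Num.bound (4 * `|R0|).
have [|eta eta0 heta] := step N 1; first lra.
exists (Num.min eta (expR (- lambda))); first by rewrite lt_min eta0 expR_gt0.
move=> x; rewrite lerBrDr addrC -lerBrDr ge_min.
have [xR|xR] := leP R0 `|x.1|.
  by apply/orP; right; apply: base; [lra|exact: u0].
apply/orP; left; apply: heta; first lra.
have : 4 * `|R0| < N%:R by apply: archi_boundP; rewrite mulr_ge0.
move: xR; rewrite ltr_norml; have := ler_norm R0; lra.
Qed.

Lemma solution_le_wave u (c R0 : R) w : unit_solution u ->
  (forall x, R0 <= enorm x -> u 0 x = 0) -> wave_profile c w ->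
  exists k, forall xi t x, unit_circle xi -> 1 <= t ->
    u t x <= w (dot x xi - k - c * t).
Proof.
move=> uu u0 pw; have [su u01] := uu; have [w01 _ _ _ [w1 _]] := pw.
have [|eta eta0 ueta] := solution_le_lt1 (R0 := R0) uu.
  by move=> x xR; apply: u0; apply: le_trans xR _; have [] := coord_le_enorm x.
pose zeta := Num.min eta 2^-1.
have zeta0 : 0 < zeta by rewrite lt_min eta0; lra.
have [M hM] := w1 zeta zeta0.
(* Within distance 1 of the half-plane [R1 <= dot x xi], the exponential bound keeps [u] below
   [expR (- 1) <= 1 / 2] up to time 1. The shift [k] keeps the wave above [1 - zeta >= 1 / 2] to the
   left of [R1] during that time, whatever the sign of [c]. *)
pose R1 := R0 + lambda * expR 1 + 2.
pose k := R1 + `|c| - M; exists k => xi t x xi1 t1.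
have uv := wave_unit_solution k pw xi1.
have leM s y : 0 <= s <= 1 -> dot y xi <= R1 -> 1 - zeta <= w (dot y xi - k - c * s).
  move=> s01 yR; apply: hM; rewrite /k.
  have : - (c * s) <= `|c|.
    apply: le_trans (ler_norm _) _; rewrite normrN normrM ler_piMr// ger0_norm; lra.
  lra.
have xiR y : R0 <= dot y xi -> u 0 y = 0.
  by move=> yR; apply: u0; apply: le_trans yR (dot_le_enorm y xi1).
have right y : R1 <= dot y xi -> u 1 y <= w (dot y xi - k - c * 1).
  move=> yR.
  have := @comparison R lambda alpha beta lambda_gt0 alpha_gt1 beta_gt1
    [set y | R1 <= dot y xi] 0 1 _ _ uu uv (lexx 0).
  apply => //; last by rewrite ler01 lexx.
  - move=> z /= zR; rewrite xiR; first by have := w01 (dot z xi - k - c * 0); lra.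
    by move: zR; rewrite /R1; have := expR_ge0 (1 : R); have := mulr_ge0 lambda_ge0 (expR_ge0 1); lra.
  - move=> s y' y'' s01 /= y'R y'y'' /negP; rewrite -ltNge => y''R.
    apply: le_trans (_ : 1 - zeta <= _); last by apply: leM => //; exact: ltW.
    apply: (@le_trans _ _ 2^-1); last by have : zeta <= 2^-1 by [rewrite ge_min lexx orbT]; lra.
    have s0 : 0 <= s by lra.
    apply: le_trans (solution_le_expR lambda_gt0 alpha_gt1 uu xi1 xiR y'' s0) _.
    apply: (@le_trans _ _ (expR (- 1))).
      rewrite ler_expR; have := disk_dot xi1 y'y''.
      have : lambda * expR 1 * s <= lambda * expR 1.
        by rewrite ler_piMr ?mulr_ge0 ?expR_ge0//; lra.
      by move: y'R; rewrite /R1; lra.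
    rewrite expRN lef_pV2 ?posrE ?expR_gt0//.
    by have := expR_ge1Dx (1 : R); lra.
have at1 y : u 1 y <= w (dot y xi - k - c * 1).
  have [|/ltW yR] := leP R1 (dot y xi); first exact: right.
  apply: le_trans (ueta y) _; apply: le_trans (leM 1 y _ yR); last lra.
  by rewrite lerD2l lerN2 ge_min lexx.
have := @comparison R lambda alpha beta lambda_gt0 alpha_gt1 beta_gt1
  setT 1 t _ _ uu uv ler01.
have tt : 1 <= t <= t by rewrite t1 lexx.
by apply => // s y y' _ _ _ [].
Qed.

Lemma outer_speed u (c d e R0 : R) w : unit_solution u ->
  (forall x, R0 <= enorm x -> u 0 x = 0) -> wave_profile c w -> c < d -> 0 < e ->
  exists T, forall t x, T <= t -> d * t <= enorm x -> u t x <= e.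
Proof.
move=> uu u0 pw cd e0; have [k hk] := solution_le_wave uu u0 pw.
have [_ _ _ _ [_ /(_ e e0) [M hM]]] := pw.
exists (Num.max 1 ((k + M) / (d - c))) => t x; rewrite ge_max => /andP[t1 tT] xd.
have [xi xi1 xiE] := polar x.
apply: le_trans (hk xi t x xi1 t1) _; apply: hM; rewrite xiE.
by move: tT; rewrite ler_pdivrMr; [rewrite mulrBr; lra|lra].
Qed.
End plane_waves.

(** * Stability of the states 0 and 1 *)

Section stability.
Variables (R : realType) (lambda : R) (alpha beta : nat).
Hypotheses (lambda_gt0 : 0 < lambda) (alpha_gt1 : (1 < alpha)%N)
  (beta_gt1 : (1 < beta)%N).

Local Notation f := (reaction lambda alpha beta).
Local Notation L := (lip lambda alpha beta).

Let lambda_ge0 : 0 <= lambda. Proof. exact: ltW. Qed.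

(** Lower bound for the rate at which the reaction decreases in [u], uniform in [m]: one of [m] and
    [1 - m] is at least 1/2. *)
Definition kappa : R := Num.min (lambda * 2^-1 ^+ alpha) (2^-1 ^+ beta).

Lemma kappa_gt0 : 0 < kappa.
Proof. by rewrite lt_min mulr_gt0 ?exprn_gt0//; lra. Qed.

Lemma kappa_le m : 0 <= m <= 1 -> kappa <= lambda * m ^+ alpha + (1 - m) ^+ beta.
Proof.
move=> m01; rewrite ge_min.
have h1 : 0 <= lambda * m ^+ alpha by apply: mulr_ge0 => //; apply: exprn_ge0; lra.
have h2 : 0 <= (1 - m) ^+ beta by apply: exprn_ge0; lra.
have [m2|m2] := leP m 2^-1; apply/orP; [right|left].
  apply: (@le_trans _ _ ((1 - m) ^+ beta)); last lra.
  by apply: lerXn2r; rewrite ?nnegrE; lra.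
apply: (@le_trans _ _ (lambda * m ^+ alpha)); last lra.
by rewrite ler_wpM2l//; apply: lerXn2r; rewrite ?nnegrE; lra.
Qed.

(** Width of the neighborhoods of 0 and 1 in which the coupling through [m], with coefficient at
    most [L * eps0], uses up at most half of the decay rate [kappa]. *)
Definition eps0 : R := Num.min 2^-1 (kappa / (2 * L)).

Lemma eps0_gt0 : 0 < eps0.
Proof.
rewrite lt_min invr_gt0 ltr0n /= divr_gt0 ?kappa_gt0// mulr_gt0//.
exact: lip_gt0.
Qed.

Lemma eps0_le : eps0 <= 2^-1. Proof. by rewrite ge_min lexx. Qed.

Lemma lip_eps0 : L * eps0 <= kappa / 2.
Proof.
have l0 : 0 < L by exact: lip_gt0.
apply: le_trans (_ : L * (kappa / (2 * L)) <= _).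
  by rewrite ler_pM2l// ge_min lexx orbT.
by rewrite le_eqVlt; apply/orP; left; apply/eqP; field; rewrite gt_eqF.
Qed.

Lemma reaction_decr_kappa u u' m : u <= u' -> 0 <= m <= 1 ->
  f u' m - f u m <= - (kappa * (u' - u)).
Proof.
move=> uu' m01; rewrite !reactionE.
have : kappa * (u' - u) <= (lambda * m ^+ alpha + (1 - m) ^+ beta) * (u' - u).
  by rewrite ler_wpM2r ?kappa_le//; lra.
lra.
Qed.

(* Near the stable states the decay in [u] dominates the coupling in [m]. *)
Lemma reaction_stable u u' m m' : 0 <= u -> u <= u' -> u' <= 1 -> 0 <= m <= 1 ->
  0 <= m' <= 1 -> m' <= m + (u' - u) ->
  (u' <= eps0 /\ m' <= eps0) \/ (1 - eps0 <= u /\ 1 - eps0 <= m) ->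
  f u' m' - f u m <= - (kappa / 2 * (u' - u)).
Proof.
move=> u0 uu' u'1 m01 m'01 mm' st.
have h := reaction_decr_kappa uu' m01.
have l0 := lip_gt0 lambda_gt0 alpha_gt1 beta_gt1.
have le := lip_eps0; have e0 := eps0_gt0; have e1 := eps0_le.
suff : f u' m' - f u' m <= kappa / 2 * (u' - u) by lra.
have k0 := kappa_gt0.
have [m'm|/ltW mm'2] := leP m' m.
  apply: (@le_trans _ _ 0); last by apply: mulr_ge0; lra.
  by rewrite subr_le0; apply: reaction_incr => //; lra.
have la0 : 0 <= lambda * alpha%:R by exact: mulr_ge0.
have b0 : 0 <= beta%:R :> R by [].
have key (p : R) : p <= L * eps0 -> p * (m' - m) <= kappa / 2 * (u' - u).
  move=> ple; apply: (@le_trans _ _ (kappa / 2 * (m' - m))).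
    by rewrite ler_wpM2r; lra.
  by rewrite ler_wpM2l; lra.
case: st => [[u'e m'e]|[ue me]].
- apply: le_trans (reaction_incr_le lambda_gt0 alpha_gt1 beta_gt1
    (c := eps0) (d := 1) _ _ _ _ _ _ _) _; try lra.
  apply: key; rewrite mulr1 /lip mulrDl; apply: lerD.
    by apply: ler_wpM2r; [lra|apply: ler_piMr; lra].
  by apply: ler_wpM2l; lra.
- apply: le_trans (reaction_incr_le lambda_gt0 alpha_gt1 beta_gt1
    (c := 1) (d := eps0) _ _ _ _ _ _ _) _; try lra.
  apply: key; rewrite mulr1 /lip mulrDl; apply: lerD.
    by apply: ler_wpM2l; lra.
  by apply: ler_wpM2r; [lra|apply: ler_piMr; lra].
Qed.

(** Truncation at 0 keeps the lowered average in the range where the reaction is monotone; it does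
    no harm later, because averages of solutions are nonnegative. *)
Lemma reaction_shift (W m q e : R) : 0 <= q -> 0 <= e -> 0 <= W - q -> W <= 1 ->
  0 <= m <= 1 -> f W m - L * (q + e) <= f (W - q) (Num.max 0 (m - q - e)).
Proof.
move=> q0 e0 Wq W1 m01; set mh := Num.max 0 (m - q - e).
have mh01 : 0 <= mh <= 1 by rewrite /mh le_max lexx /= ge_max; lra.
have mmh : m <= mh + (q + e).
  have : m - q - e <= mh by rewrite /mh le_max lexx orbT.
  lra.
have := reaction_compare lambda_gt0 alpha_gt1 beta_gt1 (u := W - q) (v := W)
  (m := mh) (m' := m) (S := q + e).
move=> /(_ _ _ mh01 m01 _ mmh) h; have := h ltac:(lra) ltac:(lra) ltac:(lra); lra.
Qed.

(** Near a stable state, lowering the profile by [q] gains [kappa / 2 * q], which pays for the error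
    [e] in the average. *)
Lemma reaction_shift_stable (W m q e : R) : 0 <= q -> 0 <= e -> 0 <= W - q ->
  W <= 1 -> 0 <= m <= 1 -> L * e <= kappa / 2 * q ->
  (W <= eps0 /\ m <= eps0) \/ (1 - eps0 <= W - q /\ 1 - eps0 <= m - q) ->
  f W m <= f (W - q) (Num.max 0 (m - q - e)).
Proof.
move=> q0 e0 Wq W1 m01 Le st.
set mh := Num.max 0 (m - q - e); set mq := Num.max 0 (m - q).
have mh01 : 0 <= mh <= 1 by rewrite /mh le_max lexx /= ge_max; lra.
have mq01 : 0 <= mq <= 1 by rewrite /mq le_max lexx /= ge_max; lra.
have mqm : m <= mq + (W - (W - q)).
  have : m - q <= mq by rewrite /mq le_max lexx orbT.
  lra.
have mqh : mq <= mh + e.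
  rewrite /mq ge_max; have : m - q - e <= mh by rewrite /mh le_max lexx orbT.
  by move: mh01 e0; lra.
have h1 : f W m - f (W - q) mq <= - (kappa / 2 * (W - (W - q))).
  apply: reaction_stable => //; first lra.
  case: st => [|[h1 h2]]; [by left|right; split=> //].
  by rewrite le_max h2 orbT.
have h2 : f (W - q) mq - f (W - q) mh <= L * e.
  by apply: reaction_compare => //; lra.
rewrite subKr in h1; lra.
Qed.

Lemma reaction_bounds u m : 0 <= u <= 1 -> 0 <= m <= 1 -> -1 <= f u m <= lambda.
Proof.
move=> u01 m01.
have a1 : 0 <= m ^+ alpha <= 1 by rewrite exprn_ge0 ?exprn_ile1//; lra.
have b1 : 0 <= (1 - m) ^+ beta <= 1 by rewrite exprn_ge0 ?exprn_ile1//; lra.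
have : 0 <= lambda * ((1 - u) * m ^+ alpha) <= lambda.
  by rewrite mulr_ge0 ?ler_piMr//; nra.
by rewrite /reaction; nra.
Qed.

Lemma reaction_lip_u u u' m : u <= u' -> 0 <= m <= 1 ->
  f u m - f u' m <= (lambda + 1) * (u' - u).
Proof.
move=> uu' m01; rewrite !reactionE.
have a1 : m ^+ alpha <= 1 by apply: exprn_ile1; lra.
have b1 : (1 - m) ^+ beta <= 1 by apply: exprn_ile1; lra.
have : lambda * m ^+ alpha <= lambda * 1 by rewrite ler_wpM2l.
move=> h; rewrite [leLHS](_ : _ = (lambda * m ^+ alpha + (1 - m) ^+ beta) * (u' - u)).
  by apply: ler_wpM2r; lra.
ring.
Qed.

Lemma reaction_lip2 u u' m m' : 0 <= u' <= 1 -> 0 <= m <= 1 -> 0 <= m' <= 1 ->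
  `|f u m - f u' m'| <= (lambda + 1) * `|u - u'| + L * `|m - m'|.
Proof.
move=> u'01 m01 m'01; apply: le_trans (ler_distD (f u' m) _ _) _; apply: lerD.
  have [uu'|/ltW uu'] := leP u u'.
    rewrite ger0_norm ?subr_ge0 ?reaction_decr// distrC ger0_norm ?subr_ge0//.
    exact: reaction_lip_u.
  rewrite distrC ger0_norm ?subr_ge0 ?reaction_decr// ger0_norm ?subr_ge0//.
  exact: reaction_lip_u.
exact: reaction_lip_norm.
Qed.

(** Strictness comes from the growth term alone. The strong maximum principle for the profile rests
    on this bound. *)
Lemma reaction_incr_strict u m m' : 0 <= u <= 1 -> 0 <= m <= m' -> m' <= 1 ->
  lambda * (1 - u) * m' ^+ alpha.-1 * (m' - m) <= f u m' - f u m.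
Proof.
move=> u01 mm' m'1.
rewrite /reaction -mulrA.
have : 0 <= u * ((1 - m) ^+ beta - (1 - m') ^+ beta).
  apply: mulr_ge0; first lra.
  by rewrite subr_ge0; apply: lerXn2r; rewrite ?nnegrE; lra.
have : m' ^+ alpha.-1 * (m' - m) <= m' ^+ alpha - m ^+ alpha.
  have a0 := prednK (ltn_trans (ltn0Sn 0) alpha_gt1).
  rewrite -[in leRHS]a0 !exprS.
  have : m * m ^+ alpha.-1 <= m * m' ^+ alpha.-1.
    by apply: ler_wpM2l; [lra|apply: lerXn2r; rewrite ?nnegrE; lra].
  lra.
move=> h1 h2.
have h3 : 0 <= lambda * (1 - u) by apply: mulr_ge0 => //; lra.
have := ler_wpM2l h3 h1; lra.
Qed.
End stability.

(** * Averages of continuous functions on the line *)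

Section line_average.
Variable R : realType.
Implicit Types (g : R -> R) (s r : R).
Local Notation mR := (measurableTypeR R).

Definition bounded_continuous g := continuous g /\ exists M, forall s, `|g s| <= M.

Lemma continuousP_dist g s (e : R) : continuous g -> 0 < e ->
  exists2 d, 0 < d & forall r, `|r - s| < d -> `|g r - g s| < e.
Proof.
move=> cg e0; have /cvgrPdist_lt/(_ e e0)/nbhs_ballP[d /= d0 hd] := cg s.
exists d => // r rs; rewrite distrC; apply: hd; by rewrite /ball /= distrC.
Qed.

Lemma bounded_continuous_measurable g : bounded_continuous g ->
  bounded_measurable (fun y => g y.1).
Proof.
move=> [cg [M hM]]; split; last by exists M.
apply: (measurableT_comp (f := g : mR -> mR)); last exact: measurable_fst.
exact: continuous_measurable_fun.
Qed.

Lemma bounded_continuous_shift g (h : R) : bounded_continuous g ->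
  bounded_continuous (fun r => g (r + h)).
Proof.
move=> [cg [M hM]]; split; last by exists M.
move=> s; apply: continuous_comp; last exact: cg.
by apply: continuousD; [move=> ?|exact: cst_continuous].
Qed.

Lemma bounded_continuousD g1 g2 : bounded_continuous g1 -> bounded_continuous g2 ->
  bounded_continuous (fun r => g1 r + g2 r).
Proof.
move=> [c1 [M1 h1]] [c2 [M2 h2]]; split.
  by move=> s; apply: continuousD; [exact: c1|exact: c2].
by exists (M1 + M2) => s; apply: le_trans (ler_normD _ _) _; exact: lerD.
Qed.

Lemma bounded_continuousZ (a : R) g : bounded_continuous g ->
  bounded_continuous (fun r => a * g r).
Proof.
move=> [cg [M hM]]; split.
  by move=> s; apply: continuousM; [exact: cst_continuous|exact: cg].
by exists (`|a| * M) => s; rewrite normrM ler_wpM2l.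
Qed.

Lemma bounded_continuous_cst (a : R) : bounded_continuous (fun=> a).
Proof. by split; [exact: cst_continuous|exists `|a|]. Qed.

Lemma lavg_le g1 g2 s : bounded_continuous g1 -> bounded_continuous g2 ->
  (forall r, s - 1 <= r <= s + 1 -> g1 r <= g2 r) -> lavg g1 s <= lavg g2 s.
Proof.
move=> b1 b2 h; rewrite lavg.unlock; apply: avg_le; [exact: bounded_continuous_measurable..|].
move=> y /(disk_dot (unit_circle_e1 R)) h1; apply: h.
by move: h1; rewrite /dot /= !mulr1 !mulr0 !addr0.
Qed.

Lemma lavg_cst (a s : R) : lavg (fun=> a) s = a.
Proof. by rewrite lavg.unlock; exact: avg_cst. Qed.

Lemma lavgD g1 g2 s : bounded_continuous g1 -> bounded_continuous g2 ->
  lavg (fun r => g1 r + g2 r) s = lavg g1 s + lavg g2 s.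
Proof. by move=> b1 b2; rewrite lavg.unlock; apply: avgD; exact: bounded_continuous_measurable. Qed.

Lemma lavgZ (a : R) g s : bounded_continuous g ->
  lavg (fun r => a * g r) s = a * lavg g s.
Proof. by move=> b; rewrite lavg.unlock; apply: avgZ; exact: bounded_continuous_measurable. Qed.

Lemma lavg_shift g s (h : R) : bounded_continuous g ->
  lavg (fun r => g (r + h)) s = lavg g (s + h).
Proof.
move=> [cg _]; have mg := continuous_measurable_fun cg.
have := avg_plane (s, 0) (- h) (unit_circle_e1 R) mg.
rewrite (_ : dot (s, 0) e1 - - h = s + h); last by rewrite /dot /=; ring.
move=> <-; rewrite lavg.unlock; congr (avg _ _); apply/funext => y; congr g.
by rewrite /dot /=; ring.
Qed.

(** A positive value at [r] would give a positive lower bound on a small box inside the disk. The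
    radius 1/2, short of 1, leaves room for this box. *)
Lemma lavg_eq0 g s : bounded_continuous g -> (forall r, 0 <= g r) ->
  lavg g s <= 0 -> forall r, `|r - s| <= 2^-1 -> g r = 0.
Proof.
move=> bg g0 gs r rs; apply/eqP; rewrite eq_le g0 andbT leNgt; apply/negP => gr.
have [d d0 hd] := continuousP_dist r bg.1 (divr_gt0 gr (ltr0n R 2)).
pose h := Num.min (4^-1) (d / 2).
have h0 : 0 < h by rewrite lt_min; lra.
have h4 : h <= 4^-1 by rewrite ge_min lexx.
have hd2 : h <= d / 2 by rewrite ge_min lexx orbT.
have bd : box (r - s, 0) h `<=` disk 0 1.
  move=> y [] /=; rewrite !in_itv /= => /andP[y1 y2] /andP[y3 y4].
  move: rs; rewrite ler_norml => /andP[r1 r2].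
  by rewrite /disk /= subr0 enorm_le// expr1n /dot; nra.
have [k k0 /(_ _ (s, 0) (g r / 2) (bounded_continuous_measurable bg))] := avg_ge_box h0 bd.
move=> hk; have : k * (g r / 2) <= lavg g s.
  rewrite lavg.unlock; apply: hk; [lra|by []|].
  move=> y [] /=; rewrite !in_itv /= => /andP[y1 y2] _.
  have : `|y.1 - r| < d by rewrite ltr_norml; lra.
  by move=> /hd; rewrite ltr_norml; lra.
have : 0 < k * (g r / 2) by rewrite mulr_gt0//; lra.
lra.
Qed.

Lemma is_derive_global_max g (dg : R -> R) s :
  (forall r : R, is_derive r (1 : R) g (dg r)) -> (forall r, g r <= g s) -> dg s = 0.
Proof.
move=> h hm; have ss : s - 1 <= s + 1 by lra.
have d0 : is_derive s (1 : R) g 0.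
  by apply: (derive1_at_max ss) => //; rewrite in_itv /=; lra.
by have [_ <-] := h s; have [_ ->] := d0.
Qed.

Lemma is_derive_continuous g (dg : R -> R) :
  (forall r : R, is_derive r (1 : R) g (dg r)) -> continuous g.
Proof.
by move=> h s; apply/differentiable_continuous/derivable1_diffP; have [] := h s.
Qed.

Lemma is_derive_shift g (dg : R -> R) (h : R) :
  (forall r : R, is_derive r (1 : R) g (dg r)) ->
  forall r : R, is_derive r (1 : R) (fun r => g (r + h)) (dg (r + h)).
Proof.
move=> hg r; have := is_derive1_comp (g := fun s => 1 * s + h)
  (hg (1 * r + h)) (is_derive_affine 1 h r).
rewrite mulr1 mul1r; congr is_derive.
by apply/funext => s /=; rewrite mul1r.
Qed.

Lemma mean_value g (dg : R -> R) (a h : R) : 0 < h ->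
  (forall r : R, is_derive r (1 : R) g (dg r)) ->
  exists2 r, a < r < a + h & g (a + h) - g a = dg r * h.
Proof.
move=> h0 hg; have ah : a < a + h by lra.
have [r|r] := @MVT _ g dg a (a + h) ah (fun t _ => hg t).
  exact/(continuous_subspaceT (is_derive_continuous hg)).
by rewrite in_itv /= => rab ->; exists r => //; congr (_ * _); ring.
Qed.
End line_average.

(** * Monotonicity of the wave profile *)

Section wave_monotone.
Variables (R : realType) (lambda : R) (alpha beta : nat).
Hypotheses (lambda_gt0 : 0 < lambda) (alpha_gt1 : (1 < alpha)%N)
  (beta_gt1 : (1 < beta)%N).
Variables (c : R) (w : R -> R).
Hypotheses (c_gt0 : 0 < c) (pw : wave_profile lambda alpha beta c w).

Local Notation f := (reaction lambda alpha beta).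
Local Notation L := (lip lambda alpha beta).
Local Notation kappa := (kappa lambda alpha beta).
Local Notation eps0 := (eps0 lambda alpha beta).

Let lambda_ge0 : 0 <= lambda. Proof. exact: ltW. Qed.
Let L_gt0 : 0 < L. Proof. exact: lip_gt0. Qed.
Let w01 s : 0 <= w s <= 1. Proof. by case: pw. Qed.

Definition wave_slope (s : R) : R := - f (w s) (lavg w s) / c.

Lemma is_derive_wave (s : R) : is_derive s (1 : R) w (wave_slope s).
Proof.
have [_ _ _ dw _] := pw; have c0 : c != 0 by rewrite gt_eqF.
(* Since [r = s + c - c * g r] and [g s = 1], the equation at time 1 along this line differentiates
   [w] at [s]. *)
pose g (r : R) : R := - c^-1 * r + (s + c) / c.
have gs : g s = 1 by rewrite /g; field.
have h : is_derive (g s) (1 : R) (fun t => w (s + c - c * t)) (f (w s) (lavg w s)).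
  by rewrite gs; have := dw (s + c) 1 ltr01; rewrite mulr1 addrK.
have := is_derive1_comp (g := g) h (is_derive_affine (- c^-1) ((s + c) / c) s).
rewrite (_ : _ \o g = w); last by apply/funext => r /=; congr w; rewrite /g; field.
by rewrite mulrN -mulNr.
Qed.

Lemma wave_bounded_continuous : bounded_continuous w.
Proof.
split; first exact: (is_derive_continuous is_derive_wave).
by exists 1 => s; rewrite ger0_norm; have := w01 s; lra.
Qed.
Let bw := wave_bounded_continuous.

Lemma lavg_wave01 s : 0 <= lavg w s <= 1.
Proof.
apply/andP; split; [rewrite -[leLHS](lavg_cst _ s)|rewrite -[leRHS](lavg_cst _ s)];
  apply: lavg_le => // [|r _]; try exact: bounded_continuous_cst;
  by have := w01 r; lra.
Qed.
Let m01 := lavg_wave01.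

Lemma lavg_le_cst (g1 g2 : R -> R) (a s : R) : bounded_continuous g1 ->
  bounded_continuous g2 -> (forall r, g1 r <= g2 r + a) ->
  lavg g1 s <= lavg g2 s + a.
Proof.
move=> b1 b2 h; rewrite -[X in _ <= _ + X](lavg_cst a s) -lavgD//; last first.
  exact: bounded_continuous_cst.
by apply: lavg_le => //; apply: bounded_continuousD => //; exact: bounded_continuous_cst.
Qed.

Definition wave_lip : R := (lambda + 1) / c.

Lemma wave_lip_gt0 : 0 < wave_lip.
Proof. by rewrite divr_gt0// addr_gt0. Qed.

Lemma wave_slope_bound s : `|wave_slope s| <= wave_lip.
Proof.
rewrite /wave_slope normrM normrN [X in _ * X]ger0_norm ?invr_ge0 ?(ltW c_gt0)//.
rewrite ler_pM2r ?invr_gt0//.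
have := reaction_bounds alpha beta lambda_gt0 (w01 s) (m01 s).
by rewrite ler_norml; have := lambda_ge0; lra.
Qed.

Lemma wave_lipP s (h : R) : 0 <= h -> `|w (s + h) - w s| <= wave_lip * h.
Proof.
rewrite le_eqVlt => /orP[/eqP <-|h0]; first by rewrite addr0 subrr normr0 mulr0.
have [r _ ->] := mean_value s h0 is_derive_wave.
by rewrite normrM (ger0_norm (ltW h0)) ler_wpM2r ?wave_slope_bound// ltW.
Qed.

Lemma lavg_wave_lipP s (h : R) : 0 <= h ->
  `|lavg w (s + h) - lavg w s| <= wave_lip * h.
Proof.
move=> h0; have bwh := bounded_continuous_shift h bw.
rewrite -lavg_shift// ler_norml; apply/andP; split.
  rewrite lerBrDr addrC lerBlDr; apply: lavg_le_cst => // r.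
  by have := wave_lipP r h0; rewrite ler_norml; lra.
rewrite lerBlDr addrC; apply: lavg_le_cst => // r.
by have := wave_lipP r h0; rewrite ler_norml; lra.
Qed.

(** Lipschitz constant of the slope, read off from the equation, whose right-hand side is Lipschitz
    in [w] and its average. It stands in for a bound on the second derivative. *)
Definition wave_lip2 : R := (lambda + 1 + L) * wave_lip / c.

Lemma wave_lip2_gt0 : 0 < wave_lip2.
Proof.
rewrite divr_gt0// mulr_gt0 ?wave_lip_gt0//.
by have := lambda_gt0; have := L_gt0; lra.
Qed.

Lemma wave_slope_lip s (h : R) : 0 <= h ->
  `|wave_slope (s + h) - wave_slope s| <= wave_lip2 * h.
Proof.
move=> h0; rewrite /wave_slope -mulrBl normrM [X in _ * X]ger0_norm; last first.
  by rewrite invr_ge0 ltW.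
rewrite /wave_lip2 mulrAC ler_pM2r ?invr_gt0// opprK addrC distrC.
apply: le_trans (reaction_lip2 lambda_gt0 alpha_gt1 beta_gt1 _ (w01 s) (m01 _) (m01 _)) _.
rewrite -[leRHS]mulrA [leRHS]mulrDl; apply: lerD.
  by apply: ler_wpM2l; [exact: addr_ge0|exact: wave_lipP].
by rewrite ler_pM2l//; exact: lavg_wave_lipP.
Qed.

Lemma wave_taylor s (h : R) : 0 < h ->
  `|w (s + h) - w s - h * wave_slope s| <= wave_lip2 * h ^+ 2.
Proof.
move=> h0; have [r rh ->] := mean_value s h0 is_derive_wave.
have e (a b : R) : a * h - h * b = (a - b) * h by ring.
rewrite e.
rewrite normrM (ger0_norm (ltW h0)) expr2 mulrA ler_pM2r//.
have := @wave_slope_lip s (r - s); rewrite subrKC => /(_ ltac:(lra)) h1.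
by apply: le_trans h1 _; rewrite ler_pM2l ?wave_lip2_gt0//; lra.
Qed.

Lemma iterate_half (P : R -> Prop) s : (forall r, P r -> P (r + 2^-1)) ->
  P s -> forall M, exists2 r, M <= r & P r.
Proof.
move=> step Ps M.
have all n : P (s + n%:R / 2).
  elim: n => [|n IH]; first by rewrite mul0r addr0.
  by rewrite -natr1 mulrDl mul1r addrA; exact: step.
exists (s + (Num.bound (2 * `|M - s|))%:R / 2) => //.
have : 2 * `|M - s| < (Num.bound (2 * `|M - s|))%:R by apply: archi_boundP; rewrite mulr_ge0.
by have := ler_norm (M - s); lra.
Qed.

(** At a point with value 1 the slope vanishes, the equation forces the average to be 1, and then
    [w = 1] within distance 1/2. Repeating this to the right contradicts the limit 0. *)
Lemma wave_lt1 s : w s < 1.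
Proof.
rewrite lt_neqAle; have /andP[_ ->] := w01 s; rewrite andbT; apply/eqP => ws.
have [_ _ _ _ [_ w0]] := pw.
have [|M hM] := w0 2^-1; first by rewrite invr_gt0.
have [|r Mr wr] := iterate_half (P := fun r => w r = 1) _ ws M; last first.
  by have := hM r Mr; rewrite wr; lra.
move=> r wr.
have : wave_slope r = 0.
  apply: (is_derive_global_max is_derive_wave) => r'.
  by rewrite wr; have /andP[] := w01 r'.
move/eqP; rewrite /wave_slope mulf_eq0 invr_eq0 (gt_eqF c_gt0) orbF oppr_eq0.
rewrite /reaction wr subrr mulr0 mul0r sub0r mul1r oppr_eq0 expf_eq0.
rewrite (ltn_trans (ltn0Sn 0) beta_gt1) /= subr_eq0 => /eqP mr.
have h : 1 + -1 * w (r + 2^-1) = 0.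
  apply: (@lavg_eq0 _ (fun r => 1 + -1 * w r) r).
  - apply: bounded_continuousD; first exact: bounded_continuous_cst.
    exact: bounded_continuousZ.
  - by move=> r'; have := w01 r'; lra.
  - rewrite lavgD; [|exact: bounded_continuous_cst|exact: bounded_continuousZ].
    by rewrite lavgZ// lavg_cst -mr mulr1 subrr.
  - by rewrite addrAC subrr add0r ger0_norm.
by lra.
Qed.

(** Mirror image of the previous argument: zeros propagate to the left, against the limit 1. *)
Lemma wave_gt0 s : 0 < w s.
Proof.
rewrite lt_neqAle; have /andP[-> _] := w01 s; rewrite andbT eq_sym; apply/eqP => ws.
have [_ _ _ _ [w1 _]] := pw.
have [|M hM] := w1 2^-1; first by rewrite invr_gt0.
have ws' : w (- - s) = 0 by rewrite opprK.
have [|r Mr wr] := iterate_half (P := fun r => w (- r) = 0) _ ws' (- M); last first.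
  by have := hM (- r); rewrite wr; lra.
move=> {ws ws'} r ws.
have : - wave_slope (- r) = 0.
  apply: (@is_derive_global_max _ (fun s => - w s) (fun s => - wave_slope s)).
    by move=> r'; apply: is_deriveN; exact: is_derive_wave.
  by move=> r'; rewrite ws; have := w01 r'; lra.
move/eqP; rewrite oppr_eq0 /wave_slope mulf_eq0 invr_eq0.
rewrite (gt_eqF c_gt0) orbF oppr_eq0 /reaction ws mul0r !subr0 mulr1 mulf_eq0.
rewrite (gt_eqF lambda_gt0) /= expf_eq0 (ltn_trans (ltn0Sn 0) alpha_gt1) /= => /eqP mr.
apply: (@lavg_eq0 _ w (- r)) => //; [by move=> r'; have /andP[] := w01 r'|by rewrite mr|].
by rewrite opprD addrAC subrr add0r normrN ger0_norm.
Qed.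

(** Strong maximum principle: at a touching point the slopes agree, hence the averages, hence
    touching spreads by 1/2 in both directions. Then [w] has period [h], impossible for a positive
    function with limit 0. *)
Lemma touching_lt (h : R) : 0 < h -> (forall s, w (s + h) <= w s) ->
  forall s, w (s + h) < w s.
Proof.
move=> h0 le s; rewrite lt_neqAle le andbT; apply/eqP => touch.
have bwh := bounded_continuous_shift h bw.
have step r : w (r + h) = w r -> forall r', `|r' - r| <= 2^-1 -> w (r' + h) = w r'.
  move=> wr r' rr'.
  have dg : forall r : R, is_derive r (1 : R) (fun r => w (r + h) - w r)
      (wave_slope (r + h) - wave_slope r).
    move=> r''; apply: is_deriveB; last exact: is_derive_wave.
    exact: (is_derive_shift h is_derive_wave).
  have : wave_slope (r + h) - wave_slope r = 0.
    apply: (is_derive_global_max (s := r) dg) => r''.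
    by rewrite wr subrr subr_le0.
  move/eqP; rewrite /wave_slope -mulrBl mulf_eq0 invr_eq0 (gt_eqF c_gt0) orbF.
  rewrite opprK addrC subr_eq0 wr => /eqP ff.
  have mm : lavg w (r + h) <= lavg w r by rewrite -lavg_shift//; exact: lavg_le.
  have me : lavg w r <= lavg w (r + h).
    rewrite leNgt; apply/negP => mlt.
    have := @reaction_incr_strict R lambda alpha beta lambda_gt0 alpha_gt1
      (w r) (lavg w (r + h)) (lavg w r) (w01 r).
    have /andP[m0 _] := m01 (r + h); have /andP[_ m1] := m01 r.
    rewrite m0 mm ff subrr => /(_ isT m1); apply/negP; rewrite -ltNge.
    rewrite !mulr_gt0 ?subr_gt0 ?exprn_gt0 ?wave_lt1//.
    exact: le_lt_trans m0 mlt.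
  have : w r' + -1 * w (r' + h) = 0.
    apply: (@lavg_eq0 _ (fun r => w r + -1 * w (r + h)) r) => //.
    - by apply: bounded_continuousD => //; exact: bounded_continuousZ.
    - by move=> r''; have := le r''; lra.
    - rewrite lavgD//; last exact: bounded_continuousZ.
      by rewrite lavgZ// lavg_shift//; lra.
  lra.
have all n r : `|r - s| <= n%:R / 2 -> w (r + h) = w r.
  elim: n r => [|n IH] r.
    by rewrite mul0r normr_le0 subr_eq0 => /eqP ->.
  rewrite -natr1 mulrDl mul1r ler_norml => /andP[r1 r2].
  have n0 : 0 <= n%:R / 2 :> R by rewrite divr_ge0.
  have [rs|rs] := leP s r.
  - apply: (step (Num.max s (r - 2^-1))).
      apply: IH; rewrite ler_norml maxEle; case: ifP => hh; lra.
    by rewrite ler_norml maxEle; case: ifP => hh; lra.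
  - apply: (step (Num.min s (r + 2^-1))).
      by apply: IH; rewrite ler_norml minEle; case: ifP => hh; lra.
    by rewrite ler_norml minEle; case: ifP => hh; lra.
have per r : w (r + h) = w r.
  apply: (all (Num.bound (2 * `|r - s|))).
  have : 2 * `|r - s| < (Num.bound (2 * `|r - s|))%:R by apply: archi_boundP; rewrite mulr_ge0.
  by lra.
have pern n : w (s + n%:R * h) = w s.
  elim: n => [|n IH]; first by rewrite mul0r addr0.
  by rewrite -natr1 mulrDl mul1r addrA per.
have [_ _ _ _ [_ w0]] := pw.
have ws0 := wave_gt0 s; have [|M hM] := w0 (w s / 2); first by rewrite divr_gt0.
have := hM (s + (Num.bound (`|M - s| / h))%:R * h); rewrite pern.
have : `|M - s| / h < (Num.bound (`|M - s| / h))%:R.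
  by apply: archi_boundP; rewrite divr_ge0// ltW.
rewrite ltr_pdivrMr// => h1 h2; have := ler_norm (M - s) => h3.
by have := h2 ltac:(lra); lra.
Qed.

Definition wave_tails (M : R) :=
  (forall s, M <= s -> w s <= eps0 /\ lavg w s <= eps0) /\
  (forall s, s <= - M -> 1 - eps0 <= w s /\ 1 - eps0 <= lavg w s).

Lemma wave_limits (e : R) : 0 < e -> exists2 M, 0 < M &
  (forall s, M <= s -> w s <= e /\ lavg w s <= e) /\
  (forall s, s <= - M -> 1 - e <= w s /\ 1 - e <= lavg w s).
Proof.
move=> e0; have [_ _ _ _ [/(_ e e0)[M1 h1] /(_ e e0)[M2 h2]]] := pw.
have a1 := ler_norm (- M1); have a2 := ler_norm M2; rewrite normrN in a1.
have n1 := normr_ge0 M1; have n2 := normr_ge0 M2.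
exists (`|M1| + `|M2| + 1); first lra.
split=> s sM; split.
- by apply: h2; lra.
- rewrite -[leRHS](lavg_cst _ s); apply: lavg_le => //.
    exact: bounded_continuous_cst.
  by move=> r rs; apply: h2; lra.
- by apply: h1; lra.
- rewrite -[leLHS](lavg_cst _ s); apply: lavg_le => //.
    exact: bounded_continuous_cst.
  by move=> r rs; apply: h1; lra.
Qed.

(* At a positive maximum of [w (s + h) - w s] the two slopes agree, which the
   stability of 0 and 1 forbids when both profiles are near the same state. *)
Lemma crossing_middle (M h s0 : R) : wave_tails M -> 0 <= h ->
  w s0 < w (s0 + h) -> exists s, [/\ - M < s, s + h < M & w s < w (s + h)].
Proof.
move=> [tr tl] h0 cross.
pose g r := w (r + h) - w r.
have dg : forall r : R, is_derive r (1 : R) g (wave_slope (r + h) - wave_slope r).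
  move=> r; apply: is_deriveB; last exact: is_derive_wave.
  exact: (is_derive_shift h is_derive_wave).
pose d := g s0; have d0 : 0 < d by rewrite /d /g subr_gt0.
(* In the tails [g] is at most [d / 2], so its maximum over [[- A', A']], which is at least [d], is
   global. *)
have [|A A0 [Ar Al]] := wave_limits (e := d / 2); first lra.
pose A' := A + `|s0|; have AA : - A' <= A' by have := normr_ge0 s0; rewrite /A'; lra.
have [s sA smax] := EVT_max AA (continuous_subspaceT (is_derive_continuous dg)).
have s0A : s0 \in `[- A', A'].
  by rewrite in_itv /= /A'; have := ler_norm s0; have := ler_norm (- s0); rewrite normrN; lra.
have ds : d <= g s by exact: smax.
have gmax r : g r <= g s.
  have n0 := normr_ge0 s0.
  have [rA|rA] := leP A' r.
    have [|+ _] := Ar (r + h); first by move: rA; rewrite /A'; lra.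
    by have := w01 r; move: ds; rewrite {2}/g /g; lra.
  have [rA'|rA'] := leP r (- A').
    have [|+ _] := Al r; first by move: rA'; rewrite /A'; lra.
    by have := w01 (r + h); move: ds; rewrite /g; lra.
  by apply: smax; rewrite in_itv /=; lra.
have gs0 : 0 < g s by lra.
have slopes := is_derive_global_max dg gmax.
have mm : lavg w (s + h) <= lavg w s + (w (s + h) - w s).
  rewrite -lavg_shift//; apply: lavg_le_cst => //.
    exact: bounded_continuous_shift.
  by move=> r; have := gmax r; rewrite /g; lra.
have ff : f (w (s + h)) (lavg w (s + h)) - f (w s) (lavg w s) = 0.
  move/eqP: slopes; rewrite /wave_slope -mulrBl mulf_eq0 invr_eq0 (gt_eqF c_gt0) orbF.
  by move/eqP; lra.
have k0 := kappa_gt0 alpha beta lambda_gt0.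
have unstable : ~ ((w (s + h) <= eps0 /\ lavg w (s + h) <= eps0) \/
    (1 - eps0 <= w s /\ 1 - eps0 <= lavg w s)).
  move=> st; have := @reaction_stable R lambda alpha beta lambda_gt0 alpha_gt1 beta_gt1
    (w s) (w (s + h)) (lavg w s) (lavg w (s + h)).
  have /andP[ws0 _] := w01 s; have /andP[_ wsh] := w01 (s + h).
  have wle : w s <= w (s + h) by move: gs0; rewrite /g subr_gt0 => /ltW.
  move=> /(_ ws0 wle wsh (m01 _) (m01 _) mm st); rewrite ff oppr_ge0 => hk.
  have : 0 < kappa / 2 * (w (s + h) - w s) by rewrite mulr_gt0 ?divr_gt0.
  by lra.
exists s; split; last by move: gs0; rewrite /g subr_gt0.
- by rewrite ltNge; apply/negP => sM; apply: unstable; right; exact: tl.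
- by rewrite ltNge; apply/negP => sM; apply: unstable; left; exact: tr.
Qed.

(** Shifts with a crossing are bounded by [2 * M]; let [hs] be their supremum. At [hs] there is no
    crossing, since it would persist for slightly larger shifts, so [touching_lt] makes the
    inequality strict, hence uniform on [[- M, M]]. Then slightly smaller shifts do not cross there
    either, although every crossing shift must have a crossing there. *)
Lemma wave_nonincreasing s (h : R) : 0 <= h -> w (s + h) <= w s.
Proof.
move=> h0; rewrite leNgt; apply/negP => cross.
have [M M0 tM] := wave_limits (eps0_gt0 lambda_gt0 alpha_gt1 beta_gt1).
pose B := [set h | 0 <= h /\ exists s, w s < w (s + h)].
have ubB : ubound B (2 * M).
  move=> h' [h'0 [s' /(crossing_middle tM h'0)]] [s''] [h1 h2 _]; lra.
have supB : has_sup B by split; [exists h; split=> //; exists s|exists (2 * M)].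
pose hs := sup B.
have hB : h <= hs by apply: ub_le_sup; [exists (2 * M)|split=> //; exists s].
have hs0 : 0 < hs.
  apply: lt_le_trans hB; rewrite lt_neqAle h0 andbT; apply/eqP => h00.
  by move: cross; rewrite -h00 addr0 ltxx.
have lw := wave_lip_gt0.
have le r : w (r + hs) <= w r.
  rewrite leNgt; apply/negP => wr; pose d := (w (r + hs) - w r) / (2 * wave_lip).
  have d0 : 0 < d by rewrite divr_gt0 ?subr_gt0// mulr_gt0.
  have : hs + d <= hs.
    apply: ub_le_sup; first by exists (2 * M).
    split; first lra.
    exists r; rewrite addrA; have := wave_lipP (r + hs) (ltW d0).
    have -> : wave_lip * d = (w (r + hs) - w r) / 2.
      by rewrite /d; field; rewrite gt_eqF.
    by rewrite ler_norml; lra.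
  lra.
have lts := touching_lt hs0 le.
pose g r := w r - w (r + hs).
have cg : continuous g.
  apply: (is_derive_continuous (dg := fun r => wave_slope r - wave_slope (r + hs))).
  move=> r; apply: is_deriveB; first exact: is_derive_wave.
  exact: (is_derive_shift hs is_derive_wave).
have MM : - M <= M by lra.
have [r0 _ rmin] := EVT_min MM (continuous_subspaceT cg).
have g0 : 0 < g r0 by rewrite /g subr_gt0.
have [|h' [h'0 [s' s'x]] hh'] := sup_adherent (eps := g r0 / wave_lip) _ supB.
  exact: divr_gt0.
have [s'' [s1 s2 s3]] := crossing_middle tM h'0 s'x.
have h'le : h' <= hs by apply: ub_le_sup; [exists (2 * M)|split=> //; exists s'].
have gs'' : g r0 <= g s'' by apply: rmin; rewrite in_itv /=; lra.
have := @wave_lipP (s'' + h') (hs - h'); rewrite subr_ge0 => /(_ h'le).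
rewrite (_ : s'' + h' + (hs - h') = s'' + hs); last by ring.
have : wave_lip * (hs - h') < g r0 by rewrite -/hs in hh'; rewrite mulrC -ltr_pdivlMr//; lra.
by move: gs''; rewrite /g ler_norml; lra.
Qed.

Lemma wave_decreasing s (h : R) : 0 < h -> w (s + h) < w s.
Proof. by move=> h0; apply: touching_lt => // r; apply: wave_nonincreasing; exact: ltW. Qed.

Lemma wave_slope_le0 s : wave_slope s <= 0.
Proof.
rewrite leNgt; apply/negP => ds.
pose h := wave_slope s / (2 * wave_lip2); have c2 := wave_lip2_gt0.
have h0 : 0 < h by rewrite divr_gt0// mulr_gt0.
have := wave_taylor s h0; have := wave_nonincreasing s (ltW h0).
have -> : wave_lip2 * h ^+ 2 = h * wave_slope s / 2.
  by rewrite /h; field; rewrite gt_eqF.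
have : 0 < h * wave_slope s by rewrite mulr_gt0.
by rewrite ler_norml; lra.
Qed.

Lemma wave_slope_bounded_continuous : bounded_continuous wave_slope.
Proof.
split; last by exists wave_lip => s; exact: wave_slope_bound.
move=> s; apply/cvgrPdist_lt => e e0.
have c2 := wave_lip2_gt0.
apply/nbhs_ballP; exists (e / wave_lip2); first exact: divr_gt0.
move=> r; rewrite /ball /= ltr_pdivlMr// mulrC => rs; apply: le_lt_trans rs.
have [sr|/ltW sr] := leP s r.
  have := @wave_slope_lip s (r - s); rewrite subr_ge0 subrKC => /(_ sr).
  by rewrite distrC [`|s - r|]distrC (ger0_norm (x := r - s)) ?subr_ge0.
have := @wave_slope_lip r (s - r); rewrite subr_ge0 subrKC => /(_ sr).
by rewrite (ger0_norm (x := s - r)) ?subr_ge0.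
Qed.

(* If the slope vanishes at [s] then [w] is flat to second order there, while
   its average strictly decreases to first order. *)
Lemma wave_slope_lt0 s : wave_slope s < 0.
Proof.
rewrite lt_neqAle wave_slope_le0 andbT; apply/eqP => ds.
have bs := wave_slope_bounded_continuous; have c2 := wave_lip2_gt0.
(* The rate at which the average decreases at [s]; were it zero, the slope would vanish near [s],
   against strict monotonicity. *)
pose k := - lavg wave_slope s.
have k0 : 0 < k.
  rewrite /k oppr_gt0 ltNge; apply/negP => ge0.
  have flat r : `|r - s| <= 2^-1 -> wave_slope r = 0.
    move=> rs; have : -1 * wave_slope r = 0.
      apply: (@lavg_eq0 _ (fun r => -1 * wave_slope r) s) => //.
      - exact: bounded_continuousZ.
      - by move=> r'; have := wave_slope_le0 r'; lra.
      - by rewrite lavgZ//; lra.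
    by lra.
  have h2 : 0 < 2^-1 :> R by rewrite invr_gt0.
  have [r rs wsr] := mean_value s h2 is_derive_wave.
  have := wave_decreasing s h2; rewrite -subr_lt0 wsr flat ?mul0r ?ltxx//.
  by rewrite ger0_norm; lra.
have fs : f (w s) (lavg w s) = 0.
  move/eqP: ds; rewrite /wave_slope mulf_eq0 invr_eq0 (gt_eqF c_gt0) orbF oppr_eq0.
  by move/eqP.
(* From [s] to [s + h] the average drops by at least [k / 2 * h], which lowers the reaction by a
   fixed multiple of [h], while the change of [w] can raise it only by order [h ^+ 2]. The reaction
   vanishes at [s] and is nonnegative at [s + h], so the second effect must make up for the first.
   Division by [h] leaves an inequality that fails for small [h]. *)
have key (h : R) : 0 < h -> wave_lip2 * h <= k / 2 ->
    lambda * (1 - w s) * lavg w s ^+ alpha.-1 * (k / 2) <= (lambda + 1) * wave_lip2 * h.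
  move=> h0 hk.
  have hh : wave_lip2 * h ^+ 2 <= k / 2 * h by rewrite expr2 mulrA ler_pM2r.
  have mle : lavg w (s + h) <= lavg w s - h * k + wave_lip2 * h ^+ 2.
    rewrite -lavg_shift// /k mulrN opprK -lavgZ// -lavgD//; last exact: bounded_continuousZ.
    apply: lavg_le_cst; [exact: bounded_continuous_shift| |].
      by apply: bounded_continuousD => //; exact: bounded_continuousZ.
    by move=> r; have := wave_taylor r h0; rewrite ler_norml; lra.
  have md : k / 2 * h <= lavg w s - lavg w (s + h) by lra.
  have wle : w s - w (s + h) <= wave_lip2 * h ^+ 2.
    by have := wave_taylor s h0; rewrite ds mulr0 subr0 ler_norml; lra.
  have fh : 0 <= f (w (s + h)) (lavg w (s + h)).
    have := wave_slope_le0 (s + h); rewrite /wave_slope.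
    by rewrite pmulr_lle0 ?invr_gt0// oppr_le0.
  have wsh := wave_nonincreasing s (ltW h0).
  have h1 := reaction_lip_u alpha beta lambda_gt0 wsh (m01 (s + h)).
  have mh0 : 0 <= lavg w (s + h) <= lavg w s.
    have : 0 <= k / 2 * h by apply: mulr_ge0; lra.
    by have := m01 (s + h); lra.
  have /andP[_ m1] := m01 s.
  have h2 := reaction_incr_strict beta lambda_gt0 alpha_gt1 (w01 s) mh0 m1.
  rewrite fs in h2.
  have h3 : lambda * (1 - w s) * lavg w s ^+ alpha.-1 * (k / 2 * h) <=
      lambda * (1 - w s) * lavg w s ^+ alpha.-1 * (lavg w s - lavg w (s + h)).
    apply: ler_wpM2l => //; apply: mulr_ge0; first apply: mulr_ge0 => //.
      by have := w01 s; lra.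
    by apply: exprn_ge0; have := m01 s; lra.
  have h4 : (lambda + 1) * (w s - w (s + h)) <= (lambda + 1) * (wave_lip2 * h ^+ 2).
    by apply: ler_wpM2l => //; exact: addr_ge0.
  rewrite -(ler_pM2r h0).
  have e (p q r : R) : p * q * r * r = p * (q * r ^+ 2) by ring.
  by rewrite e -[leLHS]mulrA; apply: le_trans h3 (le_trans h2 _); lra.
pose a := lambda * (1 - w s) * lavg w s ^+ alpha.-1 * (k / 2).
have m0 : 0 < lavg w s.
  rewrite lt_neqAle; have /andP[-> _] := m01 s; rewrite andbT eq_sym; apply/eqP => m0.
  have ws := wave_gt0 s.
  have := @lavg_eq0 _ w s bw (fun r => ltW (wave_gt0 r)); rewrite m0 => /(_ (lexx _) s).
  by rewrite subrr normr0 => /(_ ltac:(lra)); lra.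
have a0 : 0 < a by rewrite !mulr_gt0 ?subr_gt0 ?wave_lt1 ?exprn_gt0// divr_gt0.
have l1 : 0 < lambda + 1 by exact: addr_gt0.
pose h := Num.min (k / (2 * wave_lip2)) (a / (2 * ((lambda + 1) * wave_lip2))).
have l2 : 0 < (lambda + 1) * wave_lip2 by exact: mulr_gt0.
have h0 : 0 < h.
  by rewrite lt_min; apply/andP; split; apply: divr_gt0 => //; exact: mulr_gt0.
have := key h h0; rewrite -/a => /(_ _) hk.
have : wave_lip2 * h <= k / 2.
  apply: (@le_trans _ _ (wave_lip2 * (k / (2 * wave_lip2)))).
    by rewrite ler_pM2l// ge_min lexx.
  by rewrite le_eqVlt; apply/orP; left; apply/eqP; field; rewrite gt_eqF.
move=> /hk; apply/negP; rewrite -ltNge.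
apply: (@le_lt_trans _ _ (a / 2)); last lra.
apply: (@le_trans _ _ ((lambda + 1) * wave_lip2 * (a / (2 * ((lambda + 1) * wave_lip2))))).
  by rewrite (ler_pM2l l2) ge_min lexx orbT.
by rewrite le_eqVlt; apply/orP; left; apply/eqP; field; rewrite !gt_eqF.
Qed.
End wave_monotone.

(** * Expanding subsolutions and the inner bound *)

Section inner_spreading.
Variables (R : realType) (lambda : R) (alpha beta : nat).
Hypotheses (lambda_gt0 : 0 < lambda) (alpha_gt1 : (1 < alpha)%N)
  (beta_gt1 : (1 < beta)%N).

Local Notation f := (reaction lambda alpha beta).
Local Notation L := (lip lambda alpha beta).
Local Notation kappa := (kappa lambda alpha beta).
Local Notation eps0 := (eps0 lambda alpha beta).
Local Notation unit_solution := (unit_solution lambda alpha beta).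
Local Notation mR := (measurableTypeR R).

Let lambda_ge0 : 0 <= lambda. Proof. exact: ltW. Qed.
Let L_gt0 : 0 < L. Proof. exact: lip_gt0. Qed.
Let L_ge0 : 0 <= L. Proof. exact: ltW. Qed.

Section radial.
Variables (c : R) (w : R -> R).
Hypotheses (c_gt0 : 0 < c) (pw : wave_profile lambda alpha beta c w).

Local Notation slope := (wave_slope lambda alpha beta c w).
Local Notation wlip := (wave_lip lambda c).

Let w01 s : 0 <= w s <= 1. Proof. by case: pw. Qed.
Let m01 s : 0 <= lavg w s <= 1.
Proof. exact: (lavg_wave01 c_gt0 pw). Qed.
Let wlip_gt0 : 0 < wlip. Proof. exact: wave_lip_gt0. Qed.

(** Pythagoras: the component of [y] orthogonal to [xi] is at most 1 in size, and
    [dot y xi >= enorm x / 2], so the cross term in the square of [dot y xi + (enorm x)^-1] is at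
    least 1. *)
Lemma enorm_le_dot (x y xi : R * R) : unit_circle xi -> dot x xi = enorm x ->
  2 <= enorm x -> disk x 1 y -> enorm y <= dot y xi + (enorm x)^-1.
Proof.
move=> xi1 xE x2 yx; have /andP[p1 _] := disk_dot xi1 yx; rewrite xE in p1.
have x0 : 0 < enorm x by lra.
have px : 2^-1 <= dot y xi * (enorm x)^-1 by rewrite ler_pdivlMr//; lra.
have xV0 : 0 < (enorm x)^-1 by rewrite invr_gt0.
rewrite enorm_le; last lra.
have xi2 := unit_circle_dot xi1.
pose q z := - z.1 * xi.2 + z.2 * xi.1.
have pyth z : dot z z = dot z xi ^+ 2 + q z ^+ 2.
  by rewrite -[LHS]mulr1 -xi2 /q /dot; ring.
have qx : q x = 0.
  have := pyth x; rewrite xE sqr_enorm => h.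
  by apply/eqP; rewrite -sqrf_eq0; apply/eqP; lra.
have qy : q y ^+ 2 <= 1.
  have qyx : q (y - x) = q y - q x by rewrite /q /=; ring.
  rewrite qx subr0 in qyx; rewrite -qyx.
  have : dot (y - x) (y - x) <= 1 ^+ 2 by rewrite -enorm_le.
  by rewrite (pyth (y - x)) expr1n; have := sqr_ge0 (dot (y - x) xi); lra.
rewrite (pyth y) (sqrrD (dot y xi) (enorm x)^-1); have := sqr_ge0 (enorm x)^-1; lra.
Qed.

Lemma bounded_measurable_radial (x0 : R * R) (rho : R) :
  bounded_measurable (fun y => w (enorm (y - x0) - rho)).
Proof.
have [_ mw _ _ _] := pw; split; last by exists 1 => y; rewrite ger0_norm; have := w01 (enorm (y - x0) - rho); lra.
apply: (measurableT_comp mw); apply: measurable_funB; last exact: measurable_cst.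
apply: (measurableT_comp (@measurable_enorm R)).
by have [m _] := measure_preserving_translation (- x0); exact: m.
Qed.

(* The front of a large ball is nearly flat: the deviation of [enorm y] from
   its linearization is at most [1 / enorm x]. Near the center of the ball [w]
   is close to 1 and there is nothing to compare. *)
Lemma avg_radial (e : R) : 0 < e -> exists R0, forall rho x x0, R0 <= rho ->
  lavg w (enorm (x - x0) - rho) - e <= avg (fun y => w (enorm (y - x0) - rho)) x.
Proof.
move=> e0.
have [M M0 [_ hM]] := wave_limits c_gt0 pw e0.
pose X0 := 2 + wlip / e; have le0 : 0 < wlip / e by rewrite divr_gt0.
(* At distance at least [X0] from the center the flatness error [wlip / enorm x] is at most [e];
   closer in, the whole averaging disk lies where [w] is within [e] of 1. *)
exists (X0 + 1 + M) => rho x x0 hrho.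
have [_ mw _ _ _] := pw.
have -> : avg (fun y => w (enorm (y - x0) - rho)) x =
    avg (fun y => w (enorm (y - 0) - rho)) (x - x0).
  rewrite -[x in LHS](subrK x0) avg_translation.
    by congr (avg _ _); apply/funext => y; rewrite addrK subr0.
  by case: (bounded_measurable_radial x0 rho).
move: (x - x0) => {x0}x; have br := bounded_measurable_radial 0 rho.
have [xX|xX] := leP X0 (enorm x); last first.
  apply: (@le_trans _ _ (1 - e)); first by have := m01 (enorm x - rho); lra.
  rewrite -[leLHS](avg_cst _ x); apply: avg_le => //; first exact: bounded_measurable_cst.
  move=> y /disk_enorm xy; rewrite subr0.
  by have [|] := hM (enorm y - rho); lra.
have [xi xi1 xE] := polar x; have x2 : 2 <= enorm x by move: xX; rewrite /X0; lra.
have x0 : 0 < enorm x by lra.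
have xV0 : 0 < (enorm x)^-1 by rewrite invr_gt0.
have wx : wlip * (enorm x)^-1 <= e.
  by rewrite ler_pdivrMr// mulrC -ler_pdivrMr//; move: xX; rewrite /X0; lra.
rewrite -xE -(avg_plane x rho xi1 mw) -[X in _ + X <= _](avg_cst (- e) x).
have bp : bounded_measurable (fun y => w (dot y xi - rho)).
  have [sw _] := wave_unit_solution rho pw xi1.
  have := solution_bounded_measurable sw (lexx 0); congr bounded_measurable.
  by apply/funext => y; rewrite mulr0 subr0.
have bc := bounded_measurable_cst (- e).
rewrite -avgD//; apply: avg_le => //; first exact: bounded_measurableD.
move=> y xy; rewrite subr0.
have yle := enorm_le_dot xi1 xE x2 xy.
have h1 := wave_lipP lambda_gt0 c_gt0 pw (dot y xi - rho) (ltW xV0).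
have h0 : 0 <= dot y xi + (enorm x)^-1 - enorm y by lra.
have h2 := wave_nonincreasing lambda_gt0 alpha_gt1 beta_gt1 c_gt0 pw (enorm y - rho) h0.
move: h2; rewrite (_ : enorm y - rho + _ = dot y xi - rho + (enorm x)^-1); last by ring.
by move: h1; rewrite ler_norml; lra.
Qed.

(* [w (|x| - rho) - q] is a subsolution: away from the front the slack comes
   from the stability of 0 and 1, in the front from the speed deficit [c - c1]. *)
Lemma subsolution_slack (c1 qmax : R) : 0 <= c1 -> c1 < c -> 0 < qmax ->
  exists q e, [/\ 0 < q, q <= qmax, 0 < e & forall s, 0 <= w s - q ->
    - c1 * slope s <= f (w s - q) (Num.max 0 (lavg w s - q - e))].
Proof.
move=> c10 c1c qmax0.
have e00 := eps0_gt0 lambda_gt0 alpha_gt1 beta_gt1.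
have k0 := kappa_gt0 alpha beta lambda_gt0.
have e02 : 0 < eps0 / 2 by lra.
have [M M0 [tr tl]] := wave_limits c_gt0 pw e02.
have MM : - M <= M by lra.
have [cs _] := wave_slope_bounded_continuous lambda_gt0 alpha_gt1 beta_gt1 c_gt0 pw.
have [r0 _ rmax] := EVT_max MM (continuous_subspaceT cs).
pose mu := - slope r0.
have mu0 : 0 < mu.
  by rewrite oppr_gt0; exact: (wave_slope_lt0 lambda_gt0 alpha_gt1 beta_gt1 c_gt0 pw).
(* The tails are taken at [eps0 / 2], so that after lowering by [q <= eps0 / 2] the profile is still
   within [eps0] of 1. The last bound keeps the loss [L * (q + e) <= 2 * L * q] in the front below
   the gain [(c - c1) * mu]. *)
pose q := Num.min qmax (Num.min (eps0 / 2) ((c - c1) * mu / (2 * L))).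
have q0 : 0 < q.
  by rewrite !lt_min qmax0 e02 /= divr_gt0// mulr_gt0// subr_gt0.
have qe : q <= eps0 / 2 by rewrite !ge_min lexx orbT.
have qL : 2 * L * q <= (c - c1) * mu.
  by rewrite mulrC -ler_pdivlMr ?mulr_gt0// !ge_min lexx !orbT.
pose e := Num.min q (kappa * q / (2 * L)).
have e0 : 0 < e by rewrite lt_min q0 divr_gt0// mulr_gt0.
have eq_ : e <= q by rewrite ge_min lexx.
have eL : L * e <= kappa / 2 * q.
  have : e <= kappa * q / (2 * L) by rewrite ge_min lexx orbT.
  by rewrite ler_pdivlMr ?mulr_gt0//; lra.
exists q, e; split=> //; first by rewrite ge_min lexx.
move=> s; have := w01 s; have := m01 s.
have fE : f (w s) (lavg w s) = - c * slope s.
  by rewrite /wave_slope; field; rewrite gt_eqF.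
have sl0 := wave_slope_lt0 lambda_gt0 alpha_gt1 beta_gt1 c_gt0 pw s.
have c1s : (c - c1) * slope s <= 0 by rewrite pmulr_rle0 ?subr_gt0// ltW.
move=> m01' /andP[_ W1] Wq.
have tail : (w s <= eps0 /\ lavg w s <= eps0) \/
    (1 - eps0 <= w s - q /\ 1 - eps0 <= lavg w s - q) ->
    - c1 * slope s <= f (w s - q) (Num.max 0 (lavg w s - q - e)).
  move=> st; have := reaction_shift_stable lambda_gt0 alpha_gt1 beta_gt1
    (ltW q0) (ltW e0) Wq W1 m01' eL st.
  by rewrite fE; move: c1s; lra.
have [sM|sM] := leP M s.
  by apply: tail; left; have := tr s sM; move: e00; lra.
have [sM'|sM'] := leP s (- M).
  by apply: tail; right; have := tl s sM'; move: qe; lra.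
have hs : slope s <= - mu.
  by rewrite /mu opprK; apply: rmax; rewrite in_itv /= !ltW.
have h1 : (c - c1) * slope s <= (c - c1) * - mu by rewrite ler_pM2l// subr_gt0.
have h4 : L * (q + e) <= L * (q + q) by rewrite ler_pM2l// lerD2l.
have := reaction_shift lambda_gt0 alpha_gt1 beta_gt1 (ltW q0) (ltW e0) Wq W1 m01'.
by rewrite fE; move: h1 h4 qL; lra.
Qed.

Lemma radial_lower_bound (c1 qmax : R) : 0 <= c1 -> c1 < c -> 0 < qmax ->
  exists q R0 R1, [/\ 0 < q, q <= qmax & forall u s0 x0, unit_solution u ->
    0 <= s0 -> (forall x, disk x0 R1 x -> 1 - q <= u s0 x) ->
    forall t x, s0 <= t -> w (enorm (x - x0) - (R0 + c1 * (t - s0))) - q <= u t x].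
Proof.
move=> c10 c1c qmax0.
have [q [e [q0 qm e0 slack]]] := subsolution_slack c10 c1c qmax0.
have [R0 hR0] := avg_radial e0.
have [M M0 [hM _]] := wave_limits c_gt0 pw q0.
(* Beyond this radius the initial subsolution is nonpositive, since [w <= q] there; inside it is at
   most [1 - q]. *)
exists q, R0, (R0 + M); split=> // u s0 x0 uu s00 us0 T x sT.
have [su u01] := uu.
pose rho t := R0 + c1 * (t - s0).
pose Phi t y := w (enorm (y - x0) - rho t) - q.
pose dPhi t y := - c1 * slope (enorm (y - x0) - rho t).
pose z t y := Phi t y - u t y.
pose dz t y := dPhi t y - f (u t y) (avg (u t) y).
have dPhiE y (t : R) : is_derive t (1 : R) (fun t => Phi t y) (dPhi t y).
  pose a := enorm (y - x0) - R0 + c1 * s0.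
  have aE (r : R) : - c1 * r + a = enorm (y - x0) - rho r by rewrite /a /rho; ring.
  have h := is_derive_wave c_gt0 pw (- c1 * t + a).
  have := is_deriveB (is_derive1_comp (g := fun r => - c1 * r + a) h
    (is_derive_affine (- c1) a t)) (is_derive_cst q t (1 : R)).
  rewrite subr0 mulrC aE; congr is_derive.
  by apply/funext => r; rewrite /Phi -aE.
suff : z T x <= 0 by rewrite subr_le0.
apply: (@max_principle R _ z dz 1 L ler01 L_ge0 s0 T).
- move=> t y tT; have := u01 t y; have := w01 (enorm (y - x0) - rho t).
  by rewrite /z /Phi => h1 /(_ ltac:(lra)); lra.
- move=> y t; apply: (@continuousB _ _ (subspace `[s0, T])
    (fun t => Phi t y) (fun t => u t y)); last exact: (solution_continuous su s00).
  exact/continuous_subspaceT/(is_derive_continuous (dPhiE y)).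
- move=> t y tT _; have [_ _ _ du] := su; have t0 : 0 < t by lra.
  exact: (is_deriveB (dPhiE y t) (du y t t0)).
- move=> t y S tT S01 zS; rewrite /z subr_gt0 => uPhi.
  have t0 : 0 <= t by lra.
  have rho0 : R0 <= rho t.
    have : 0 <= c1 * (t - s0) by apply: mulr_ge0 => //; lra.
    by rewrite /rho; lra.
  have bu := solution_bounded_measurable su t0.
  have mS : lavg w (enorm (y - x0) - rho t) - q - e - S <= avg (u t) y.
    apply: (@le_trans _ _ (avg (fun y => w (enorm (y - x0) - rho t)) y + (- q - S))).
      by have := hR0 (rho t) y x0 rho0; lra.
    rewrite -[X in _ + X](avg_cst (- q - S) y).
    have br := bounded_measurable_radial x0 (rho t).
    have bc := bounded_measurable_cst (- q - S).
    rewrite -avgD//; apply: avg_le => //; first exact: bounded_measurableD.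
    by move=> y' _; have := zS y'; rewrite /z /Phi; lra.
  have := slack (enorm (y - x0) - rho t).
  have := avg_unit y uu t0; have := u01 t y t0; have := w01 (enorm (y - x0) - rho t).
  move: mS uPhi; rewrite /dz /dPhi /Phi.
  move: (enorm (y - x0) - rho t) => s.
  move: (avg (u t) y) (u t y) => mu U mS uPhi W01 U01 mu01 /(_ ltac:(lra)) hs.
  set mh := Num.max 0 (lavg w s - q - e) in hs.
  have mh01 : 0 <= mh <= 1 by rewrite /mh le_max lexx /= ge_max; have := m01 s; lra.
  have mhS : mh <= mu + S by rewrite /mh ge_max; apply/andP; split; lra.
  have h2 : f (w s - q) mh - f U mu <= L * S.
    by apply: reaction_compare => //; lra.
  lra.
- move=> y; rewrite subr_le0 /Phi /rho subrr mulr0 addr0.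
  have [yR|yR] := leP (enorm (y - x0)) (R0 + M).
    by have := us0 y yR; have := w01 (enorm (y - x0) - R0); lra.
  have [|h _] := hM (enorm (y - x0) - R0); first lra.
  by have := u01 s0 y s00; lra.
- by rewrite lexx andbT.
Qed.
End radial.

(** On the diagonal the reaction is [p * (1 - p)] times [lambda * p ^+ alpha.-1 - (1 - p) ^+
    beta.-1], a strictly increasing factor on the unit interval that vanishes at [pi0]. *)
Lemma fixed_point_gap (pi0 sigma : R) : is_interior_fixed_point lambda alpha beta pi0 ->
  pi0 < sigma -> sigma <= 1 ->
  0 < lambda * sigma ^+ alpha.-1 - (1 - sigma) ^+ beta.-1.
Proof.
move=> [/andP[p0 p1] fp] ps s1.
have a0 := prednK (ltn_trans (ltn0Sn 0) alpha_gt1).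
have b0 := prednK (ltn_trans (ltn0Sn 0) beta_gt1).
have ap : (0 < alpha.-1)%N by rewrite -ltnS a0.
have gp : lambda * pi0 ^+ alpha.-1 - (1 - pi0) ^+ beta.-1 = 0.
  move: fp; rewrite /reaction -a0 -b0 /= !exprS.
  rewrite (_ : _ - _ = pi0 * (1 - pi0) * (lambda * pi0 ^+ alpha.-1 - (1 - pi0) ^+ beta.-1)); last by ring.
  move/eqP; rewrite mulf_eq0 mulf_eq0 (gt_eqF p0) /= subr_eq0 (gt_eqF p1) /=.
  by move/eqP.
have : lambda * pi0 ^+ alpha.-1 < lambda * sigma ^+ alpha.-1.
  by rewrite ltr_pM2l// ltrXn2r -?lt0n// ?ltW//; lra.
have : (1 - sigma) ^+ beta.-1 <= (1 - pi0) ^+ beta.-1.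
  by apply: lerXn2r; rewrite ?nnegrE; lra.
lra.
Qed.

(** On [[sigma, nu]] the diagonal reaction is at least [mu], so the level [nu] is reached after time
    [(nu - sigma) / mu]. The extra radius [2 / e] reduces the boundary error to
    [expR (- (2 / e)) <= e / 2]. *)
Lemma solution_lift (pi0 sigma e : R) : is_interior_fixed_point lambda alpha beta pi0 ->
  pi0 < sigma -> sigma < 1 -> 0 < e ->
  exists T r, [/\ 0 <= T, 0 <= r & forall u s0 x0, unit_solution u -> 0 <= s0 ->
    (forall x, disk x0 r x -> sigma <= u s0 x) -> 1 - e <= u (s0 + T) x0].
Proof.
move=> fp ps s1 e0; have [/andP[p0 _] _] := fp.
have g0 := fixed_point_gap fp ps (ltW s1).
set g := _ - _ in g0; pose nu := Num.max sigma (1 - e / 2).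
have nu1 : nu < 1 by rewrite gt_max s1 /=; lra.
have snu : sigma <= nu by rewrite le_max lexx.
pose mu := sigma * (1 - nu) * g.
have mu0 : 0 < mu by apply: mulr_gt0 => //; apply: mulr_gt0; lra.
have hmu p : sigma <= p <= nu -> mu <= f p p.
  move=> pp; have a0 := prednK (ltn_trans (ltn0Sn 0) alpha_gt1).
  have b0 := prednK (ltn_trans (ltn0Sn 0) beta_gt1).
  rewrite /reaction -[in leRHS]a0 -[in leRHS]b0 !exprS.
  rewrite [leRHS](_ : _ = p * (1 - p) * (lambda * p ^+ alpha.-1 - (1 - p) ^+ beta.-1)); last by ring.
  apply: ler_pM; [by rewrite mulr_ge0//; lra|exact: ltW| |].
    by apply: ler_pM; lra.
  apply: lerB; first by rewrite ler_pM2l//; apply: lerXn2r; rewrite ?nnegrE; lra.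
  by apply: lerXn2r; rewrite ?nnegrE; lra.
pose T := (nu - sigma) / mu.
have T0 : 0 <= T by rewrite divr_ge0 ?subr_ge0// ltW.
have sT : sigma + mu * T = nu by rewrite /T mulrC divfK ?gt_eqF// addrC subrK.
have LT0 : 0 <= L * expR 1 * T.
  by apply: mulr_ge0 => //; apply: mulr_ge0 => //; exact: expR_ge0.
have e20 : 0 < 2 / e by rewrite divr_gt0.
exists T, (L * expR 1 * T + 2 / e); split => //; first by rewrite addr_ge0// ltW.
move=> u s0 x0 uu s00 us0.
have s_ge0 : 0 <= sigma by lra.
have := solution_ge_linear lambda_gt0 alpha_gt1 beta_gt1 uu s00 T0 s_ge0 (ltW nu1)
  (ltW mu0) hmu _ us0.
rewrite sT => /(_ (lexx _)); apply: le_trans.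
rewrite opprD addrA subrr sub0r.
have : expR (- (2 / e)) <= e / 2.
  rewrite expRN -[e / 2]invrK lef_pV2 ?posrE ?expR_gt0 ?invr_gt0 ?divr_gt0//.
  by rewrite invf_div; have := expR_ge1Dx (2 / e); lra.
have : 1 - e / 2 <= nu by rewrite le_max lexx orbT.
lra.
Qed.

Lemma inner_speed (pi0 sigma c rho : R) w :
  is_interior_fixed_point lambda alpha beta pi0 -> pi0 < sigma ->
  wave_profile lambda alpha beta c w -> 0 <= rho -> rho < c ->
  exists2 r, 0 < r & forall u x0, unit_solution u ->
    (forall x, disk x0 r x -> sigma <= u 0 x) ->
    forall e, 0 < e -> exists T, forall t x, T <= t -> enorm x <= rho * t ->
      1 - e <= u t x.
Proof.
move=> fp ps pw rho0 rhoc; have [/andP[p0 p1] _] := fp.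
have c0 : 0 < c by exact: le_lt_trans rho0 rhoc.
(* The lift starts from a level below 1, and [sigma] may be larger. *)
pose sg := Num.min sigma ((1 + pi0) / 2).
have psg : pi0 < sg by rewrite lt_min ps; lra.
have sg1 : sg < 1 by rewrite gt_min; apply/orP; right; lra.
pose c1 := (rho + c) / 2.
have c10 : 0 <= c1 by rewrite /c1; lra.
have c1c : c1 < c by rewrite /c1; lra.
(* For [q] up to this bound the plateau height [1 - 2 * q] is at least [(1 + pi0) / 2], the starting
   level of the second lift. *)
have q0 : 0 < (1 - pi0) / 4 by lra.
have [q [R0 [R1 [qpos qle hrad]]]] := radial_lower_bound c0 pw c10 c1c q0.
have [T1 [r1 [T10 r10 lift1]]] := solution_lift fp psg sg1 qpos.
have [M M0 [_ hM]] := wave_limits c0 pw qpos.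
exists (`|R1| + r1 + 1); first by have := normr_ge0 R1; lra.
move=> u x0 uu us0 e e0.
have h1 y : disk x0 R1 y -> 1 - q <= u T1 y.
  move=> yx; rewrite -[T1]add0r; apply: lift1 => // y' y'y.
  apply: (@le_trans _ _ sigma); first by rewrite ge_min lexx.
  apply: us0; rewrite /disk /=.
  have := enormD (y' - y) (y - x0); rewrite addrA subrK.
  by move: yx y'y; rewrite /disk /=; have := ler_norm R1; lra.
have h2 := hrad u T1 x0 uu T10 h1.
have ps2 : pi0 < (1 + pi0) / 2 by lra.
have s21 : (1 + pi0) / 2 < 1 by lra.
have [T2 [r2 [T20 r20 lift2]]] := solution_lift fp ps2 s21 e0.
(* The plateau outruns [rho * t] by [(c1 - rho) * t], which eventually absorbs the constants
   collected in [C]. *)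
pose C := enorm x0 + r2 + c1 * (T1 + T2) + M - R0.
exists (Num.max (T1 + T2) (C / (c1 - rho))) => t x; rewrite ge_max => /andP[tT tC] xt.
have cr : 0 < c1 - rho by rewrite /c1; lra.
rewrite ler_pdivrMr// in tC.
rewrite -[t](subrK T2); apply: lift2 => //; first lra.
move=> y yx; have tT1 : T1 <= t - T2 by lra.
apply: le_trans (h2 (t - T2) y tT1).
have [|h3 _] := hM (enorm (y - x0) - (R0 + c1 * (t - T2 - T1))); last by lra.
have := enormD (y - x) (x - x0); rewrite addrA subrK.
have := enormD x (- x0).
have -> : enorm (- x0) = enorm x0 by rewrite /enorm /dot /=; congr Num.sqrt; ring.
move: yx tC; rewrite /disk /= /C; lra.
Qed.
End inner_spreading.

(** * Conclusion *)

Section plane_topology.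
Variable R : realType.

Lemma enormZ (a : R) (x : R * R) : 0 <= a -> enorm (a * x.1, a * x.2) = a * enorm x.
Proof.
move=> a0; rewrite /enorm (_ : dot _ _ = a ^+ 2 * dot x x); last by rewrite /dot /=; ring.
by rewrite sqrtrM ?sqr_ge0// sqrtr_sqr ger0_norm.
Qed.

Lemma continuous_enorm : continuous (@enorm R).
Proof.
move=> x; apply: (@continuous_comp _ _ _ (fun y : R * R => dot y y) Num.sqrt).
  by apply: (@continuousD _ _ _ (fun y : R * R => y.1 * y.1) (fun y => y.2 * y.2));
    apply: continuousM; (exact: cvg_fst || exact: cvg_snd).
exact: sqrt_continuous.
Qed.

Lemma compact_square (M : R) : compact (`[- M, M] `*` `[- M, M] : set (R * R)).
Proof. by apply: compact_setX; exact: segment_compact. Qed.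

Lemma closed_bounded_compact (A : set (R * R)) (M : R) : closed A ->
  (forall x, A x -> enorm x <= M) -> compact A.
Proof.
move=> cA AM.
apply: (@subclosed_compact _ A (`[- M, M] `*` `[- M, M]) cA (@compact_square M)).
move=> x /AM xM.
have [] := coord_le_enorm x; rewrite !ler_norml => h1 h2.
by split; rewrite /= in_itv /=; lra.
Qed.

Lemma compact_enorm_bounded (A : set (R * R)) : compact A ->
  exists M, forall x, A x -> enorm x <= M.
Proof.
move=> cA; have [A0|/set0P A0] := eqVneq A set0; first by exists 0 => x; rewrite A0.
have cn : {within A, continuous (@enorm R)} by exact/continuous_subspaceT/continuous_enorm.
have [y _ ymax] := compact_EVT_max A0 cA cn.
by exists (enorm y) => x Ax; apply: ymax; rewrite inE.
Qed.

Lemma exists_min_enorm (A : set (R * R)) : closed A -> A !=set0 ->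
  exists2 y, A y & forall x, A x -> enorm y <= enorm x.
Proof.
move=> cA [a Aa]; pose B := A `&` [set x | enorm x <= enorm a].
have cn := continuous_enorm.
have cB : compact B.
  apply: (@closed_bounded_compact _ (enorm a)); last by move=> x [].
  apply: closedI => //.
  have := @preimage_closed _ _ (@enorm R) [set r | r <= enorm a] (fun x _ => cn x).
  by apply; exact: closed_le.
have B0 : B !=set0 by exists a; split => /=.
have [y] := compact_EVT_min B0 cB (continuous_subspaceT cn).
rewrite inE => -[Ay ya] ymin; exists y => // x Ax.
have [xa|/ltW xa] := leP (enorm x) (enorm a); first by apply: ymin; rewrite inE.
exact: le_trans ya xa.
Qed.

Lemma bounded_set_enorm (A : set (R * R)) : bounded_set A ->
  exists M, forall x, A x -> enorm x <= M.
Proof.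
move=> [M [_ hM]]; exists (2 * (`|M| + 1)) => x Ax.
have : `|x| <= `|M| + 1 by apply: hM => //; have := ler_norm M; lra.
rewrite prod_normE ge_max => /andP[]; rewrite !ler_norml => h1 h2.
have n0 := normr_ge0 M; rewrite enorm_le; last lra.
rewrite /dot; nra.
Qed.

Lemma interior_step (A : set (R * R)) x xi : interior A x -> unit_circle xi ->
  exists2 d : R, 0 < d & A (x.1 + d * xi.1, x.2 + d * xi.2).
Proof.
move=> /nbhs_ballP[e /= e0 he] xi1; exists (e / 2); first lra.
have [] := coord_le_enorm xi; rewrite xi1 => h1 h2.
have e2 : 0 <= e / 2 by lra.
have small (y : R) : `|y| <= 1 -> `|e / 2 * y| < e.
  move=> y1; rewrite normrM ger0_norm//.
  by apply: (@le_lt_trans _ _ (e / 2 * 1)); [rewrite ler_wpM2l|lra].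
by apply: he; split; rewrite /ball /= opprD addrA subrr sub0r normrN small.
Qed.

Lemma limn_einf_eventually_le (v : (\bar R)^nat) (l : \bar R) (N : nat) :
  (forall n, (N <= n)%N -> (v n <= l)%E) -> (limn_einf v <= l)%E.
Proof.
move=> h; rewrite limn_einf_lim (cvg_lim _ (@cvg_einfs_sup _ v))//.
apply: ge_ereal_sup => _ [n _ <-].
apply: le_trans (h (maxn n N) (leq_maxr _ _)).
by apply: ereal_inf_lbound; exists (maxn n N) => //=; exact: leq_maxl.
Qed.

Lemma limn_einf_eventually_ge (v : (\bar R)^nat) (l : \bar R) (N : nat) :
  (forall n, (N <= n)%N -> (l <= v n)%E) -> (l <= limn_einf v)%E.
Proof.
move=> h; rewrite limn_einf_lim (cvg_lim _ (@cvg_einfs_sup _ v))//.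
apply: le_trans (_ : einfs v N <= _)%E; last by apply: ereal_sup_ubound; exists N.
by apply: le_ereal_inf_tmp => _ [n /= Nn <-]; exact: h.
Qed.
End plane_topology.

Theorem theorem1p3 (R : realType) (lambda : R) (alpha beta : nat) (pi0 : R)
    (cstar : R * R -> R)
    (lambda_gt0 : 0 < lambda) (alpha_gt1 : (1 < alpha)%N) (beta_gt1 : (1 < beta)%N)
    (hpi0 : is_interior_fixed_point lambda alpha beta pi0)
    (hcstar : forall xi : R * R, unit_circle xi ->
       is_plane_wave_speed lambda alpha beta xi (cstar xi))
    (hS : interior (spread_set cstar) !=set0) :
  (forall Sm : set (R * R), closed Sm -> Sm !=set0 ->
     Sm `<=` interior (spread_set cstar) ->
     forall sigma : R, pi0 < sigma ->
     exists2 r : R, 0 < r &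
       forall u : R -> R * R -> R,
         is_solution lambda alpha beta u -> admissible_init (u 0) ->
         (exists x0 : R * R, forall x, disk x0 r x -> sigma <= u 0 x) ->
         limn_einf (fun n : nat =>
           ereal_inf [set (u n%:R x)%:E | x in scale n%:R Sm]) = 1%:E)
  /\
  (forall (u : R -> R * R -> R) (K Sp : set (R * R)),
     is_solution lambda alpha beta u -> admissible_init (u 0) ->
     compact K -> (forall x, ~ K x -> u 0 x = 0) ->
     open Sp -> bounded_set Sp -> spread_set cstar `<=` Sp ->
     (limn_einf (fun n : nat =>
        ereal_sup [set (u n%:R x)%:E | x in ~` scale n%:R Sp]) <= pi0%:E)%E).
Proof.
have unit u : is_solution lambda alpha beta u -> admissible_init (u 0) ->
    unit_solution lambda alpha beta u.
  move=> su [_ u01]; split; first exact: su.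
  by move=> t x; apply: solution_unit su u01 t x.
split.
- move=> Sm cSm Sm0 SmS sigma ps.
  have dotE x (xi : R * R) (d : R) : unit_circle xi ->
      dot (x.1 + d * xi.1, x.2 + d * xi.2) xi = dot x xi + d.
    move=> /unit_circle_dot xi1; rewrite -[d in RHS]mulr1 -xi1 /dot /=; ring.
  (* The four coordinate directions already bound the spread set, so [Sm] is compact and has a
     farthest point. *)
  have SmM x : Sm x -> enorm x <=
      `|cstar (1, 0)| + `|cstar (-1, 0)| + `|cstar (0, 1)| + `|cstar (0, -1)|.
    move=> /SmS /interior_subset Sx.
    have cs (a b : R) : a ^+ 2 + b ^+ 2 = 1 -> x.1 * a + x.2 * b <= `|cstar (a, b)|.
      move=> ab; apply: le_trans (ler_norm _); apply: (Sx (a, b)).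
      by rewrite /unit_circle /= /enorm /dot /= -!expr2 ab sqrtr1.
    have h1 : x.1 <= `|cstar (1, 0)|.
      by have := cs 1 0; rewrite mulr1 mulr0 addr0; apply; ring.
    have h2 : - x.1 <= `|cstar (-1, 0)|.
      by have := cs (-1) 0; rewrite mulrN1 mulr0 addr0; apply; ring.
    have h3 : x.2 <= `|cstar (0, 1)|.
      by have := cs 0 1; rewrite mulr1 mulr0 add0r; apply; ring.
    have h4 : - x.2 <= `|cstar (0, -1)|.
      by have := cs 0 (-1); rewrite mulrN1 mulr0 add0r; apply; ring.
    have ex : enorm x <= `|x.1| + `|x.2|.
      rewrite enorm_le ?addr_ge0// sqrrD /dot -!expr2 !real_normK ?num_real//.
      by have := mulr_ge0 (normr_ge0 x.1) (normr_ge0 x.2); lra.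
    move: (normr_ge0 (cstar (1, 0))) (normr_ge0 (cstar (-1, 0))).
    move: (normr_ge0 (cstar (0, 1))) (normr_ge0 (cstar (0, -1))) => a0 b0 c0 d0.
    have n1 : `|x.1| <= `|cstar (1, 0)| + `|cstar (-1, 0)| by rewrite ler_norml; lra.
    have n2 : `|x.2| <= `|cstar (0, 1)| + `|cstar (0, -1)| by rewrite ler_norml; lra.
    lra.
  have cn : {within Sm, continuous (@enorm R)}.
    exact/continuous_subspaceT/continuous_enorm.
  have [y] := compact_EVT_max Sm0 (closed_bounded_compact cSm SmM) cn.
  rewrite inE => Smy ymax.
  have [xi xi1 yxi] := polar y.
  (* A small outward step from [y] stays in the spread set, which makes [enorm y < cstar xi]
     strict. *)
  have [d d0 Sd] := interior_step (SmS _ Smy) xi1.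
  have yc : enorm y < cstar xi.
    by have := Sd xi xi1; rewrite dotE// yxi; lra.
  have [w pw] := plane_wave_profile xi1 (hcstar xi xi1).
  have [r r0 hr] := inner_speed lambda_gt0 alpha_gt1 beta_gt1 hpi0 ps pw (enorm_ge0 y) yc.
  exists r => // u su au [x0 ux0]; have uu := unit u su au.
  have [_ u01] := uu.
  have scaleE n x : scale n%:R Sm x -> enorm x <= enorm y * n%:R.
    move=> [x' Smx' <-]; rewrite enormZ// mulrC ler_wpM2r//.
    by apply: ymax; rewrite inE.
  apply/eqP; rewrite eq_le; apply/andP; split.
    apply: (@limn_einf_eventually_le _ _ _ 0) => n _.
    have [z Smz] := Sm0.
    apply: (@le_trans _ _ (u n%:R (n%:R * z.1, n%:R * z.2))%:E).
      by apply: ereal_inf_lbound; exists (n%:R * z.1, n%:R * z.2) => //; exists z.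
    by rewrite lee_fin; have /andP[] := u01 n%:R (n%:R * z.1, n%:R * z.2) (ler0n _ _).
  apply/lee_addgt0Pr => e e0; rewrite -leeBlDr// -EFinB.
  have [T hT] := hr u x0 uu ux0 e e0.
  apply: (@limn_einf_eventually_ge _ _ _ (Num.bound `|T|)) => n Tn.
  apply: le_ereal_inf_tmp => _ [x /scaleE xn <-]; rewrite lee_fin; apply: hT => //.
  apply: le_trans (ler_norm T) _; apply: le_trans (ltW (archi_boundP (normr_ge0 T))) _.
  by rewrite ler_nat.
- move=> u K Sp su au cK uK oSp bSp SSp; have uu := unit u su au.
  have [R0 hR0] := compact_enorm_bounded cK.
  have [R1 hR1] := bounded_set_enorm bSp.
  have far x : R0 + 1 <= enorm x -> u 0 x = 0.
    by move=> xR; apply: uK => /hR0; lra.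
  have nSp0 : ~` Sp !=set0.
    exists (`|R1| + 1, 0) => /hR1; have [+ _] := coord_le_enorm (`|R1| + 1, 0 : R).
    by rewrite /= ger0_norm; have := ler_norm R1; have := normr_ge0 R1; lra.
  have [y nSpy ymin] := exists_min_enorm (open_closedC oSp) nSp0.
  (* Every point outside the set scaled by [n] has norm at least [n] times [enorm y], so a single
     wave slower than [enorm y] suffices; its direction witnesses that [y] is not in the spread
     set. *)
  have [xi xi1 yxi] : exists2 xi, unit_circle xi & cstar xi < dot y xi.
    apply: contrapT => h; apply: nSpy; apply: SSp => xi xi1.
    by rewrite leNgt; apply/negP => yxi; apply: h; exists xi.
  have yc : cstar xi < enorm y by apply: lt_le_trans yxi (dot_le_enorm y xi1).
  have [w pw] := plane_wave_profile xi1 (hcstar xi xi1).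
  have [/andP[p0 _] _] := hpi0.
  have [T hT] := outer_speed lambda_gt0 alpha_gt1 beta_gt1 uu far pw yc p0.
  (* The successor ensures [n > 0], so that points can be divided by [n]. *)
  apply: (@limn_einf_eventually_le _ _ _ (Num.bound `|T|).+1) => n Tn.
  apply: ge_ereal_sup => _ [x nx <-]; rewrite lee_fin; apply: hT.
    apply: le_trans (ler_norm T) _; apply: le_trans (ltW (archi_boundP (normr_ge0 T))) _.
    by rewrite ler_nat ltnW.
  have n0 : 0 < n%:R :> R by rewrite ltr0n (leq_ltn_trans _ Tn).
  have nn0 : n%:R != 0 :> R by rewrite gt_eqF.
  pose x' := (x.1 / n%:R, x.2 / n%:R).
  have xE : x = (n%:R * x'.1, n%:R * x'.2).
    by case: x @x' {nx} => a b /=; congr (_, _); rewrite mulrC divfK.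
  have nx' : ~ Sp x' by move=> Sx'; apply: nx; exists x'.
  by rewrite xE enormZ ?(ltW n0)// mulrC ler_pM2l// ymin.
Qed.
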